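(* Let $\mathbb K\in\{\mathbb R,\mathbb C\}$ and let $(E,[\cdot,\cdot])$ be a locally convex Poisson vector space over $\mathbb K$ with respect to $\mathcal S=c$. Let $U\subseteq E$ be an open subset. Then the map $$\Psi\colon C^\infty_{\mathbb K}(U,\mathbb K)\to C^\infty_{\mathbb K}(U,E),\quad f\mapsto X_f,$$ taking $f$ to its Hamiltonian vector field $X_f$, is continuous and linear.
   Context: All locally convex spaces are Hausdorff. For a locally convex $\mathbb K$-vector space $E$, $E'_c$ is the space of continuous linear functionals with the topology of uniform convergence on compact subsets of $E$; $\eta_{E,c}\colon E\to(E'_c)'_c$, $\eta_{E,c}(x)(\lambda)=\lambda(x)$. A topological space is a $k_{\mathbb R}$-space if it is Hausdorff and each real-valued function on it which is continuous on every compact subset is continuous. A bilinear map $\beta\colon E_1\times E_2\to F$ between locally convex spaces is $c$-hypocontinuous in its second argument if it is separately continuous and for each compact $M\subseteq E_2$ and each $0$-neighbourhood $W\subseteq F$ there is a $0$-neighbourhood $V\subseteq E_1$ with $\beta(V\times M)\subseteq W$. A locally convex Poisson vector space with respect to $\mathcal S=c$ is a locally convex $\mathbb K$-vector space $E$ such that $E\times E$ is a $k_{\mathbb R}$-space and $\eta_{E,c}$ is a topological embedding, together with a bilinear map $[\cdot,\cdot]\colon E'_c\times E'_c\to E'_c$ which makes $E'_c$ a Lie algebra, is $c$-hypocontinuous in its second argument, and satisfies $\eta_{E,c}(x)\circ\mathrm{ad}_\lambda\in\eta_{E,c}(E)$ for all $x\in E$ and $\lambda\in E'$, where $\mathrm{ad}_\lambda=\mathrm{ad}(\lambda):=[\lambda,\cdot]\colon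 E'\to E'$. A map $f\colon U\to F$ from an open subset $U\subseteq E$ to a locally convex $\mathbb K$-space is $C^\infty_{\mathbb K}$ if it is continuous and all iterated directional derivatives $d^jf(x,y_1,\ldots,y_j)=(D_{y_j}\cdots D_{y_1}f)(x)$ over $\mathbb K$, $j\in\mathbb N$, exist and define continuous maps $d^jf\colon U\times E^j\to F$. $C^\infty_{\mathbb K}(U,F)$ is the space of such maps, endowed with the compact-open $C^\infty$-topology: the initial topology with respect to the maps $C^\infty_{\mathbb K}(U,F)\to C(U\times E^j,F)_{c.o.}$, $f\mapsto d^jf$, $j\in\mathbb N_0$ ($d^0f=f$), where the right-hand sides carry the compact-open topology. For $f\in C^\infty_{\mathbb K}(U,\mathbb K)$, the Hamiltonian vector field is $X_f\colon U\to E$, $X_f(x):=\eta_{E,c}^{-1}\bigl(\eta_{E,c}(x)\circ\mathrm{ad}(f'(x))\bigr)$, where $f'(x)=df(x,\cdot)\in E'$; it is known to be a $C^\infty_{\mathbb K}$-map. *)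

(* Defs.v *)
From HB Require Import structures.
From mathcomp Require Import all_boot all_order all_algebra.
From mathcomp Require Import sesquilinear complex.
From mathcomp Require Import boolp classical_sets functions convex.
From mathcomp Require Import reals interval_inference topology normedtype tvs.

Set Implicit Arguments.
Unset Strict Implicit.
Unset Printing Implicit Defensive.
Import Order.TTheory GRing.Theory Num.Theory.
Import numFieldTopology.Exports.
Local Open Scope classical_set_scope.
Local Open Scope ring_scope.

Variant real_or_complex (R : realType) : numFieldType -> Prop :=
| RealScalars : real_or_complex R R
| ComplexScalars : real_or_complex R R[i].

(* [tvsType] is already locally convex *)
HB.mixin Record Topological_isHausdorff T & Topological T := {
  hausdorff_subproof : hausdorff_space T }.

#[short(type="lcsType")]
HB.structure Definition Lcs (K : numFieldType) :=
  {E of Tvs K E & Topological_isHausdorff E}.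

Lemma lcs_hausdorff (K : numFieldType) (E : lcsType K) : hausdorff_space E.
Proof. exact: hausdorff_subproof. Qed.

HB.instance Definition _ (K : numFieldType) :=
  Topological_isHausdorff.Build K^o (@norm_hausdorff K K^o).

Section compact_dual.
Variables (K : numFieldType) (E : tvsType K).

Definition cont_lin : {pred E -> K^o} :=
  [pred f : E -> K^o | `[< linear f /\ continuous f >]].

Lemma cont_lin_submod_closed : submod_closed cont_lin.
Proof.
split=> [|a f g].
  apply/asboolP; split=> [a x y|x].
    by rewrite /= scaler0 addr0.
  exact: cvg_cst.
move=> /asboolP[lf cf] /asboolP[lg cg]; apply/asboolP; split=> [b x y|x].
  rewrite /= !fctE lf lg; rewrite !scalerDr !scalerA mulrC.
  by rewrite addrACA.
have h1 : (fun y => a *: f y) @ x --> a *: f x.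
  apply: (@continuous2_cvg _ _ _ _ _ _ (fun=> a : K^o) f
    (fun u v => u *: v) a (f x)); [|exact: cvg_cst|exact: cf].
  exact: (@scale_continuous K K^o (a, f x)).
apply: (@continuous2_cvg _ _ _ _ _ _ (fun y => a *: f y) g
  (fun u v => u + v) (a *: f x) (g x)); [|exact: h1|exact: cg].
exact: (@add_continuous K^o (a *: f x, g x)).
Qed.

HB.instance Definition _ :=
  GRing.isSubmodClosed.Build K (E -> K^o) cont_lin cont_lin_submod_closed.

Record dualc := Dualc { dualc_fun :> E -> K^o ; _ : dualc_fun \in cont_lin }.

HB.instance Definition _ := [isSub for dualc_fun].
HB.instance Definition _ := [Choice of dualc by <:].
HB.instance Definition _ := [SubChoice_isSubLmodule of dualc by <:].

Definition dualc_family (l : dualc) : {family compact, E -> K^o} := l.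

HB.instance Definition _ :=
  Topological.copy dualc (initial_topology dualc_family).

Lemma dualc_linear (l : dualc) : linear l.
Proof. by have /asboolP[] := valP l. Qed.

Lemma dualc_continuous (l : dualc) : continuous l.
Proof. by have /asboolP[] := valP l. Qed.

Lemma dualcD (l m : dualc) x : (l + m) x = l x + m x.
Proof. by []. Qed.

Lemma dualcZ (a : K) (l : dualc) x : (a *: l) x = a * l x.
Proof. by []. Qed.

Lemma dualcP (l m : dualc) : l =1 m -> l = m.
Proof. by move=> lm; apply: val_inj; apply/funext. Qed.

Lemma dualc_nbhs_ball (l : dualc) (C : set E) (e : K) : compact C -> 0 < e ->
  nbhs l [set m : dualc | forall x, C x -> `|l x - m x| < e].
Proof.
move=> cC e0.
have ent : @entourage K^o [set xy | `|xy.1 - xy.2| < e].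
  by rewrite -entourage_ballE; exists e.
have cl : continuous (dualc_family : dualc -> _).
  exact: (@initial_continuous dualc _ dualc_family).
exact: (cl l _ (fam_nbhs (dualc_family l) ent cC)).
Qed.

Lemma dualc_nbhsP (l : dualc) (A : set dualc) : nbhs l A <->
  exists C e, [/\ compact C, 0 < e &
    [set m : dualc | forall x, C x -> `|l x - m x| < e] `<=` A].
Proof.
split; last first.
  by move=> [C [e [cC e0 sA]]]; apply: filterS sA _; exact: dualc_nbhs_ball.
pose G := filter_from
  [set CV : set E * set (K^o * K^o) | compact CV.1 /\ entourage CV.2]
  (fun CV => [set g : E -> K^o | forall x, CV.1 x -> CV.2 (l x, g x)]).
have FG : Filter G.
  apply: filter_from_filter.
    by exists (set0, setT); split; [exact: compact0|exact: entourageT].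
  move=> [C V] [C' V'] [/= cC eV] [/= cC' eV'].
  exists (C `|` C', V `&` V'); first by split; [exact: compactU|exact: filterI].
  move=> g /= h; split=> x Cx; first by apply: (h x _).1; left.
  by apply: (h x _).2; right.
have Gl : {family compact, G --> (l : E -> K^o)}.
  apply/fam_cvgP => C cC P /uniform_nbhs[V [eV VP]].
  by apply: filterS VP _; exists (C, V).
move=> [_ /= [[B oB <-] Bl] BA].
have /Gl[[C V] [/= cC]] : nbhs (dualc_family l) B by exact: open_nbhs_nbhs.
rewrite -entourage_ballE => -[e /= e0 eV] CVB.
exists C, e; split=> // m lm; apply/BA/CVB => x Cx; apply: eV; exact: lm.
Qed.

Lemma dualc_bounded (l : dualc) (C : set E) : compact C ->
  exists2 M : K, 0 < M & forall x, C x -> `|l x| < M.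
Proof.
move=> /compact_near_coveringP cC.
have [|M [M0 lM]] := @filter_ex _ (pinfty_nbhs K) _
  [set M | 0 < M /\ forall x, C x -> `|l x| < M]; last by exists M.
apply: filterI; first exact: nbhs_pinfty_gt.
apply: (cC K (pinfty_nbhs K) (fun M x => `|l x| < M)) => x Cx.
have h1 : \forall y \near x, `|l x - l y| < 1.
  have /(_ [set z | `|l x - z| < 1]) := @dualc_continuous l x; apply.
  exact: (@nbhsx_ballx _ K^o).
exists ([set y | `|l x - l y| < 1], [set M | `|l x| + 1 < M]).
  split=> //; apply: nbhs_pinfty_gt; rewrite realD//; exact: normr_real.
move=> [y M] [/= xy xM]; apply: lt_trans xM.
rewrite -(subrK (l x) (l y)) (le_lt_trans (ler_normD _ _))//.
by rewrite addrC ltrD2l distrC.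
Qed.

Let dualc_add_continuous : continuous (fun x : dualc * dualc => x.1 + x.2).
Proof.
move=> [l m] A /dualc_nbhsP[C [e [cC e0 eA]]].
have e20 : 0 < e / 2 by rewrite divr_gt0.
exists ([set m' : dualc | forall x, C x -> `|l x - m' x| < e / 2],
        [set m' : dualc | forall x, C x -> `|m x - m' x| < e / 2]).
  by split; exact: dualc_nbhs_ball.
move=> [l' m'] [/= ll' mm']; apply: eA => x Cx.
rewrite !dualcD opprD addrACA (le_lt_trans (ler_normD _ _))// (splitr e).
by rewrite ltrD ?ll' ?mm'.
Qed.

Let dualc_scale_continuous : continuous (fun z : K^o * dualc => z.1 *: z.2).
Proof.
move=> [k l] A /dualc_nbhsP[C [e [cC e0 eA]]].
have [M M0 lM] := dualc_bounded l cC.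
have k0 : 0 < `|k| + 1 :> K by rewrite ltr_wpDl.
pose d := e / 2 / (`|k| + 1).
pose d' := e / 2 / M.
have d0 : 0 < d by rewrite !divr_gt0.
have d'0 : 0 < d' by rewrite !divr_gt0.
exists ([set k' : K^o | `|k - k'| < d'] `&` [set k' : K^o | `|k - k'| < 1],
        [set m' : dualc | forall x, C x -> `|l x - m' x| < d]).
  split; last exact: dualc_nbhs_ball.
  by apply: filterI; exact: (@nbhsx_ballx _ K^o).
move=> [k' l'] [/= [kk' k1] ll']; apply: eA => x Cx.
rewrite !dualcZ.
have -> : k * l x - k' * l' x = (k - k') * l x + k' * (l x - l' x).
  by rewrite mulrBl mulrBr addrA subrK.
rewrite (le_lt_trans (ler_normD _ _))// (splitr e) !normrM ltrD//.
  rewrite (@le_lt_trans _ _ (`|k - k'| * M))//.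
    by rewrite ler_wpM2l// ltW// lM.
  by rewrite -ltr_pdivlMr.
have k'k : `|k'| <= `|k| + 1.
  rewrite -(subrK k k') addrC (le_trans (ler_normD _ _))// lerD2l.
  by rewrite distrC ltW.
rewrite (@le_lt_trans _ _ ((`|k| + 1) * `|l x - l' x|))//.
  by rewrite ler_wpM2r.
by rewrite mulrC -ltr_pdivlMr// ll'.
Qed.

Let dualc_locally_convex : exists2 B : set_system dualc,
  (forall b, b \in B -> convex_set b) & basis B.
Proof.
pose b (l : dualc) (C : set E) (e : K) := [set m : dualc |
  exists d : K, [/\ 0 <= d, d < e & forall x, C x -> `|l x - m x| <= d]].
exists [set A | exists l C e, [/\ compact C, 0 < e & A = b l C e]].
  move=> _ /set_mem[l [C [e [cC e0 ->]]]] m m' t.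
  move=> /set_mem[d [d0 de md]] /set_mem[d' [d'0 d'e m'd']]; apply/mem_set.
  have t0 : 0 <= t%:num by [].
  have t1 : 0 <= 1 - t%:num :> K by rewrite subr_ge0.
  exists (t%:num * d + (1 - t%:num) * d'); split.
  - by rewrite addr_ge0// mulr_ge0.
  - have [->|tn0] := eqVneq t%:num (0 : K).
      by rewrite mul0r add0r subr0 mul1r.
    rewrite -[ltRHS]mul1r -[X in X * e](subrK t%:num) addrC [ltRHS]mulrDl.
    by rewrite ler_ltD// ?ler_wpM2l// ?(ltW d'e)// ltr_pM2l// lt_neqAle eq_sym tn0.
  - move=> x Cx.
    have -> : l x - (conv t (m : convex_lmodType dualc) m') x =
        t%:num * (l x - m x) + (1 - t%:num) * (l x - m' x).
      rewrite -[X in _ - X]/(t%:num * m x + (1 - t%:num) * m' x).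
      by rewrite !mulrBr addrACA -mulrDl -opprD [t%:num + _]addrC subrK mul1r.
    rewrite (le_trans (ler_normD _ _))// !normrM (ger0_norm t0) (ger0_norm t1).
    by apply: lerD; apply: ler_wpM2l => //; [exact: md|exact: m'd'].
split.
  move=> _ [l [C [e [cC e0 ->]]]]; rewrite openE => m [d [d0 de md]].
  have ed0 : 0 < (e - d) / 2 by rewrite divr_gt0// subr_gt0.
  apply: filterS (dualc_nbhs_ball m cC ed0) => m' mm'.
  exists (d + (e - d) / 2); split.
  - by rewrite addr_ge0// ltW.
  - rewrite -[ltRHS](subrK d) addrC ltrD2r [ltRHS]splitr ltrDl//.
  - move=> x Cx; rewrite -(subrK (m x) (l x)) -addrA.
    by rewrite (le_trans (ler_normD _ _))// lerD// ?md// ltW// mm'.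
move=> l A /dualc_nbhsP[C [e [cC e0 eA]]].
exists (b l C e) => /=.
  split; first by exists l, C, e.
  by exists 0; split=> // x _; rewrite subrr normr0.
by move=> m [d [d0 de md]]; apply: eA => x Cx; rewrite (le_lt_trans (md x Cx)).
Qed.

HB.instance Definition _ := PreTopologicalLmod_isTvs.Build K dualc
  dualc_add_continuous dualc_scale_continuous dualc_locally_convex.
HB.instance Definition _ := PreTopologicalNmodule_isTopologicalNmodule.Build
  dualc dualc_add_continuous.
HB.instance Definition _ := TopologicalNmodule_isTopologicalLmodule.Build
  K dualc dualc_scale_continuous.
HB.instance Definition _ := Uniform_isTvs.Build K dualc dualc_locally_convex.

Lemma dualc_eval_continuous (x : E) : continuous (fun l : dualc => l x : K^o).
Proof.
move=> l A; rewrite -nbhs_ballE => -[e /= e0 eA].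
apply: filterS (dualc_nbhs_ball l (@compact_set1 _ x) e0) => m lm.
by apply: eA; exact: lm.
Qed.

Let dualc_hausdorff : hausdorff_space dualc.
Proof.
move=> l m lm; apply: dualcP => x; apply: (@norm_hausdorff K K^o) => A B lA mB.
have [n [nA nB]] := lm _ _ (dualc_eval_continuous lA) (dualc_eval_continuous mB).
by exists (n x).
Qed.

HB.instance Definition _ := Topological_isHausdorff.Build dualc dualc_hausdorff.

End compact_dual.

Section evaluation.
Variables (K : numFieldType) (E : tvsType K).

Lemma eta_cont_lin (x : E) :
  (fun l : dualc E => l x) \in @cont_lin K (dualc E).
Proof. by apply/asboolP; split=> //; exact: dualc_eval_continuous. Qed.

Definition eta (x : E) : dualc (dualc E) := Dualc (eta_cont_lin x).

End evaluation.

Definition topological_embedding (S T : topologicalType) (f : S -> T) :=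
  injective f /\
  forall A : set S, open A <-> exists2 B : set T, open B & A = f @^-1` B.

Definition kR_space (R : realType) (X : topologicalType) :=
  hausdorff_space X /\
  forall f : X -> R,
    (forall C, compact C -> {within C, continuous f}) -> continuous f.

Definition c_hypocontinuous2 (K : numFieldType) (E1 E2 F : tvsType K)
    (b : E1 -> E2 -> F) :=
  [/\ forall x, continuous (b x),
      forall y, continuous (b ^~ y) &
      forall (M : set E2) (W : set F), compact M -> nbhs 0 W ->
        exists2 V : set E1, nbhs 0 V &
          forall x y, V x -> M y -> W (b x y)].

Definition lie_bracket (K : numFieldType) (V : lmodType K) (b : V -> V -> V) :=
  [/\ bilinear_for *:%R *:%R b,
      forall x, b x x = 0 &
      forall x y z, b x (b y z) + b y (b z x) + b z (b x y) = 0].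

Record lc_poisson (R : realType) (K : numFieldType) (E : lcsType K)
    (br : dualc E -> dualc E -> dualc E) : Prop := {
  poisson_kR : kR_space R (E * E)%type ;
  poisson_eta : topological_embedding (@eta K E) ;
  poisson_lie : lie_bracket br ;
  poisson_hypo : c_hypocontinuous2 br ;
  poisson_ad : forall (x : E) (l : dualc E),
    exists y : E, eta x \o br l = eta y :> (dualc E -> K) }.

Section smooth_maps.
Variables (K : numFieldType) (E : tvsType K) (F : lcsType K) (U : set E).
Implicit Types (f : U -> F) (x : U) (y : E).

(* [f] is extended by 0 outside [U]; as [U] is open this does not affect the
   limit at 0 *)
Definition diff_quotient f y x (t : K^o) : F :=
  t^-1 *: ('valL_0 f (\val x + t *: y) - f x).

Definition dir_derivable f y x :=
  exists l : F, diff_quotient f y x @ 0^' --> l.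

Definition dir_derive f y x : F :=
  xget 0 [set l | diff_quotient f y x @ 0^' --> l].

(* [iter_derive f [:: y_1; ...; y_j] = D_{y_j} ... D_{y_1} f] *)
Definition iter_derive f (ys : seq E) : U -> F := foldl dir_derive f ys.

Definition dmap (j : nat) f (p : U * {ptws 'I_j -> E}) : F :=
  iter_derive f (codom p.2) p.1.

Definition smooth : {pred U -> F} := [pred f : U -> F | `[<
  [/\ continuous f,
      forall ys y x, dir_derivable (iter_derive f ys) y x &
      forall j, continuous (@dmap j f)] >]].

Lemma dir_deriveP f y x (l : F) :
  diff_quotient f y x @ 0^' --> l -> dir_derive f y x = l.
Proof.
move=> fl; apply: (cvg_unique (@lcs_hausdorff _ F) _ fl).
exact: (@xgetPex _ _ [set l | diff_quotient f y x @ 0^' --> l]) (ex_intro _ l fl).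
Qed.

Lemma diff_quotient_cvgDZ (a : K) f g y x (l m : F) :
  diff_quotient f y x @ 0^' --> l -> diff_quotient g y x @ 0^' --> m ->
  diff_quotient (a *: f + g) y x @ 0^' --> a *: l + m.
Proof.
move=> fl gm.
have -> : diff_quotient (a *: f + g) y x =
    (fun t => a *: diff_quotient f y x t + diff_quotient g y x t).
  apply/funext => t; rewrite /diff_quotient scalerA mulrC -scalerA -scalerDr.
  congr (_ *: _); rewrite !fctE /= scalerBr opprD addrACA; congr (_ + _).
  by case: ('oinv_set_val _) => [z|] //=; rewrite scaler0 addr0.
apply: (@continuous2_cvg _ _ _ _ _ _ _ _ (fun u v => u + v) (a *: l) m) gm.
  exact: (@add_continuous F (a *: l, m)).
apply: (@continuous2_cvg _ _ _ _ _ _ (fun=> a : K^o) _ (fun u v => u *: v) a l).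
- exact: (@scale_continuous K F (a, l)).
- exact: cvg_cst.
- exact: fl.
Qed.

Lemma iter_deriveDZ (a : K) f g ys :
  (forall ys y x, dir_derivable (iter_derive f ys) y x) ->
  (forall ys y x, dir_derivable (iter_derive g ys) y x) ->
  iter_derive (a *: f + g) ys = a *: iter_derive f ys + iter_derive g ys.
Proof.
move=> df dg; elim/last_ind: ys => // ys y IH.
rewrite /iter_derive -!cats1 !foldl_cat /= -!/(iter_derive _ _) IH.
apply/funext => x; apply: dir_deriveP.
have [l fl] := df ys y x; have [m gm] := dg ys y x.
rewrite [X in _ --> X]/(_ *: _ + _) (dir_deriveP fl) (dir_deriveP gm).
exact: diff_quotient_cvgDZ.
Qed.

Lemma cvgDZ (T : topologicalType) (a : K) (f g : T -> F) :
  continuous f -> continuous g -> continuous (a *: f + g).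
Proof.
move=> cf cg x.
apply: (@continuous2_cvg _ _ _ _ _ _ _ _ (fun u v => u + v) (a *: f x) (g x)).
- exact: (@add_continuous F (a *: f x, g x)).
- apply: (@continuous2_cvg _ _ _ _ _ _ (fun=> a : K^o) _ (fun u v => u *: v)
    a (f x)).
  + exact: (@scale_continuous K F (a, f x)).
  + exact: cvg_cst.
  + exact: cf.
- exact: cg.
Qed.

Lemma smooth_submod_closed : submod_closed smooth.
Proof.
split=> [|a f g /asboolP[cf df jf] /asboolP[cg dg jg]]; apply/asboolP.
  have q0 y x : diff_quotient 0 y x @ 0^' --> (0 : F).
    rewrite (_ : diff_quotient _ _ _ = fun=> 0); first exact: cvg_cst.
    apply/funext => t; rewrite /diff_quotient /=.
    by case: ('oinv_set_val _) => [z|] /=; rewrite subr0 scaler0.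
  have i0 ys : iter_derive 0 ys = 0.
    elim: ys => // y ys; rewrite /iter_derive /= (_ : dir_derive 0 y = 0)//.
    by apply/funext => x; exact: dir_deriveP.
  split.
  - exact: (@cst_continuous U F 0).
  - by move=> ys y x; rewrite i0; exists 0; exact: q0.
  - move=> j; rewrite (_ : @dmap j 0 = cst 0); first exact: cst_continuous.
    by apply/funext => p; rewrite /dmap i0.
split.
- exact: cvgDZ.
- move=> ys y x; rewrite iter_deriveDZ//.
  have [l fl] := df ys y x; have [m gm] := dg ys y x.
  by exists (a *: l + m); exact: diff_quotient_cvgDZ.
- move=> j; rewrite (_ : @dmap j _ = a *: @dmap j f + @dmap j g).
    exact: cvgDZ (jf j) (jg j).
  by apply/funext => p; rewrite /dmap iter_deriveDZ.
Qed.

HB.instance Definition _ :=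
  GRing.isSubmodClosed.Build K (U -> F) smooth smooth_submod_closed.

Record Cinf := MkCinf { Cinf_fun :> U -> F ; _ : Cinf_fun \in smooth }.

HB.instance Definition _ := [isSub for Cinf_fun].
HB.instance Definition _ := [Choice of Cinf by <:].
HB.instance Definition _ := [SubChoice_isSubLmodule of Cinf by <:].

Definition Cinf_dmap (j : nat) (f : Cinf) :
  {compact-open, (U * {ptws 'I_j -> E})%type -> F} := @dmap j f.

HB.instance Definition _ := Topological.copy Cinf
  (sup_topology (fun j : nat =>
    Topological.class (initial_topology (@Cinf_dmap j)))).

End smooth_maps.

Section hamiltonian.
Variables (K : numFieldType) (E : tvsType K) (U : set E).
Variable br : dualc E -> dualc E -> dualc E.

(* $f'(x) = df(x, \cdot)$; for smooth [f] over the reals or the complex numbers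
   and open [U] it is a continuous linear form, so that the default value of
   [insubd] is not used: see [differentialE] *)
Definition differential (f : U -> K^o) (x : U) : dualc E :=
  insubd 0 (fun y => dir_derive f y x).

Lemma differentialE (f : U -> K^o) (x : U) (y : E) :
  (fun z => dir_derive f z x) \in @cont_lin K E ->
  differential f x y = dir_derive f y x.
Proof. by move=> fx; rewrite /differential /insubd insubT. Qed.

Definition eta_inv (m : dualc E -> K^o) : E :=
  xget 0 [set y | eta y = m :> (dualc E -> K^o)].

Definition hamiltonian (f : U -> K^o) (x : U) : E :=
  eta_inv (eta (\val x) \o br (differential f x)).

End hamiltonian.

Lemma eta_hamiltonian (R : realType) (K : numFieldType) (E : lcsType K)
    (br : dualc E -> dualc E -> dualc E) (U : set E) (f : U -> K^o) (x : U) :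
  lc_poisson R br ->
  eta (hamiltonian br f x) = eta (\val x) \o br (differential f x)
    :> (dualc E -> K^o).
Proof.
move=> P; have [y hy] := poisson_ad P (\val x) (differential f x).
apply: (@xgetPex _ 0 [set z | eta z = _ :> (dualc E -> K^o)]).
by exists y; exact: esym hy.
Qed.

(* Main.v *)
(** Write beta(l, x) for the element of E with m(beta(l, x)) = [l, m](x), so that
    X_f(x) = beta(f'(x), x). Since E carries the topology of uniform convergence on
    compact subsets of E'_c, the hypocontinuity of the bracket makes beta
    hypocontinuous with respect to compact sets of x. The Leibniz rule gives
      d^j X_f(x, y_1, .., y_j) = beta(d^j f'(x, y_1, .., y_j), x)
                                 + sum_i beta(d^(j-1) f'(x, .., y_i omitted, ..), y_i).
    Restricted to y_1 = .. = y_j this function of (x, y) in U x E is continuous on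
    compact sets, hence continuous by the k_R-property of E x E. The whole map is
    symmetric and multilinear in the y_i, so polarization yields its continuity on
    U x E^j; no k_R-property of E^(j+1) is needed. Continuity of f |-> X_f follows
    from the same formula, which is linear in f, and the hypocontinuity of beta. *)
Require Import Defs.
From HB Require Import structures.
From mathcomp Require Import all_boot all_order all_algebra.
From mathcomp Require Import complex ring lra.
From mathcomp Require Import boolp classical_sets functions.
From mathcomp Require Import reals topology normedtype tvs derive.

Set Implicit Arguments.
Unset Strict Implicit.
Unset Printing Implicit Defensive.
Import Order.TTheory GRing.Theory Num.Theory numFieldTopology.Exports.
Local Open Scope classical_set_scope.
Local Open Scope ring_scope.

(** The k_R-property speaks of real-valued functions on all of E x E, whereas X_f and its
    derivatives are E-valued and live over U. Seminorms of the form sup |m(v)|, with m in a compact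
    subset of E'_c, make the values real, and a cut-off built from such a seminorm replaces U x E by
    E x E. Polarization presupposes symmetry and multilinearity of d^j X_f, so these must be known
    before its continuity. They are therefore read off the Leibniz formula, from the corresponding
    properties of the derivatives of f. The latter rest on a mean value inequality, proved for both
    fields at once: functions are restricted to real segments, and a unimodular factor reduces them
    to real values. *)

(* The structure common to R and R[i] through which the real mean value theorem and
   the real-valued k_R-property are applied to K-valued functions. *)
Record scalars (R : realType) (K : numFieldType) := Scalars {
  emb : {rmorphism R -> K} ;
  re : K -> R ;
  emb_le : forall r s : R, (emb r <= emb s) = (r <= s) ;
  re_emb : forall r : R, re (emb r) = r ;
  reB : forall z w : K, re (z - w) = re z - re w ;
  re_embM : forall (r : R) (z : K), re (emb r * z) = r * re z ;
  re_le_norm : forall z : K, emb (re z) <= `|z| ;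
  norm_emb : forall z : K, emb (re `|z|) = `|z| ;
  re_phase : forall z : K, exists2 w : K, `|w| = 1 & emb (re (w * z)) = `|z| }.

Lemma real_scalars (R : realType) : inhabited (scalars R R).
Proof.
constructor; apply: (@Scalars R R idfun id) => //= [z|z].
  exact: ler_norm.
exists (if 0 <= z then 1 else -1); first by case: ifP; rewrite ?normrN normr1.
case: ifPn => [z0|]; first by rewrite mul1r ger0_norm.
by rewrite -ltNge mulN1r => z0; rewrite ltr0_norm.
Qed.

Lemma complex_scalars (R : realType) : inhabited (scalars R R[i]).
Proof.
have normE (z : R[i]) : real_complex R (complex.Re `|z|) = `|z|.
  by rewrite normc_def.
constructor; apply: (@Scalars R R[i] (@real_complex R) (@complex.Re R)) => //=.
- by move=> r s; rewrite lecR.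
- by move=> [a b] [c d].
- by move=> r [a b] /=; rewrite mul0r subr0.
- by move=> z; rewrite (le_trans _ (normc_ge_Re z))// lecR ler_norm.
- move=> z; have [->|z0] := eqVneq z 0.
    by exists 1; rewrite ?normr1// mulr0 normr0.
  have nz : `|z| != 0 by rewrite normr_eq0.
  exists (z^* / `|z|)%C; first by rewrite normrM normcJ normfV normr_id divff.
  have -> : (z^*%C / `|z|) * z = `|z|.
    by rewrite mulrAC [_ * z]mulrC -sqr_normc expr2 mulfK.
  exact: normE.
Qed.

Lemma real_or_complex_scalars (R : realType) (K : numFieldType) :
  real_or_complex R K -> inhabited (scalars R K).
Proof. by case; [exact: real_scalars|exact: complex_scalars]. Qed.

(** * Directional derivatives, mean values and symmetry *)

Section linear_fun.
Context {K : numFieldType} {V W : lmodType K} (L : V -> W) (lL : linear L).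

Lemma linear_fun0 : L 0 = 0.
Proof. by have := lL (-1) 0 0; rewrite scaler0 addr0 scaleN1r addNr. Qed.

Lemma linear_funD x y : L (x + y) = L x + L y.
Proof. by have := lL 1 x y; rewrite !scale1r. Qed.

Lemma linear_funZ c x : L (c *: x) = c *: L x.
Proof. by have := lL c x 0; rewrite linear_fun0 !addr0. Qed.

Lemma linear_funB x y : L (x - y) = L x - L y.
Proof. by rewrite -scaleN1r linear_funD linear_funZ scaleN1r. Qed.

End linear_fun.

Section tvs_cvg.
Context {K : numFieldType} {E : tvsType K}.

Lemma tvs_cvgD {T : Type} (F : set_system T) (f g : T -> E) a b :
  Filter F -> f @ F --> a -> g @ F --> b -> (fun x => f x + g x) @ F --> a + b.
Proof.
move=> FF fa gb; apply: (@continuous2_cvg _ _ _ _ _ _ f g (fun u v => u + v) a b) => //.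
exact: (@add_continuous E (a, b)).
Qed.

Lemma tvs_cvgZ {T : Type} (F : set_system T) (k : T -> K^o) (f : T -> E) c a :
  Filter F -> k @ F --> c -> f @ F --> a ->
  (fun x => k x *: f x) @ F --> (c : K) *: a.
Proof.
move=> FF kc fa; apply: (@continuous2_cvg _ _ _ _ _ _ k f (fun u v => u *: v) c a) => //.
exact: (@scale_continuous K E (c, a)).
Qed.

Lemma scalar_cvgP {T : Type} (F : set_system T) (f : T -> K^o) (l : K^o) :
  Filter F ->
  f @ F --> l <-> forall e : K, 0 < e -> \forall t \near F, `|f t - l| < e.
Proof.
move=> FF; split=> [fl e e0|h].
  have := fl [set z | `|z - l| < e]; apply.
  apply: filterS (nbhsx_ballx (l : K^o) e e0) => z.
  by rewrite -ball_normE /= distrC.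
move=> A; rewrite -nbhs_ballE => -[e /= e0 eA]; rewrite nbhs_filterE.
rewrite /nbhs/=; apply: filterS (h _ e0) => t te; apply: eA.
by rewrite -ball_normE /= distrC.
Qed.

Lemma near0P (P : set K^o) : (\forall t \near (0 : K^o)^', P t) <->
  exists2 d : K, 0 < d & forall t, t != 0 -> `|t| < d -> P t.
Proof.
have -> : (\forall t \near (0 : K^o)^', P t) = (\forall t \near (0 : K^o), t != 0 -> P t).
  by [].
split=> [/nbhs_ballP[d /= d0 dP]|[d d0 dP]].
  by exists d => // t t0 td; apply: dP => //; rewrite -ball_normE /= sub0r normrN.
apply/nbhs_ballP; exists d => //= t.
by rewrite -ball_normE /= sub0r normrN => td t0; exact: dP.
Qed.

End tvs_cvg.

Lemma pos_lower_bound (K : numFieldType) (d e : K) : 0 < d -> 0 < e ->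
  exists m, [/\ 0 < m, m <= d & m <= e].
Proof.
move=> d0 e0; have := real_leVge (gtr0_real d0) (gtr0_real e0).
by case/orP => le; [exists d|exists e].
Qed.

Section open_subset.
Context {K : numFieldType} {E : tvsType K} (U : set E) (hU : open U).

Lemma set_typeP (w : E) : U w -> exists u : U, \val u = w.
Proof. by move=> Uw; exists (exist _ w (mem_set Uw)). Qed.

Lemma val_in (u : U) : U (\val u).
Proof. by case: u => w /= /set_mem. Qed.

Lemma val_continuous : continuous (\val : U -> E).
Proof. exact: (@initial_continuous U E \val). Qed.

Lemma nbhs_val (u : U) (N : set U) : nbhs u N ->
  exists2 O : set E, nbhs (\val u) O & forall w, O w -> exists2 v : U, \val v = w & N v.
Proof.
move=> [_ [[O oO <-] Ou ON]]; exists (O `&` U).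
  apply: filterI; first exact: open_nbhs_nbhs.
  by apply: open_nbhs_nbhs; split=> //; exact: val_in.
move=> w [Ow /set_typeP[v vw]]; exists v => //.
by apply: ON; rewrite /preimage /= set_valE vw.
Qed.

Lemma line_continuous (x y z : E) :
  continuous (fun st : K^o * K^o => x + st.1 *: y + st.2 *: z).
Proof.
move=> st; apply: tvs_cvgD; first apply: tvs_cvgD; first exact: cvg_cst.
  by apply: (@tvs_cvgZ _ _ _ _ (fun st => st.1) (fun=> y)); [exact: cvg_fst|exact: cvg_cst].
by apply: (@tvs_cvgZ _ _ _ _ (fun st => st.2) (fun=> z)); [exact: cvg_snd|exact: cvg_cst].
Qed.

Lemma nbhs_plane (u : U) (N : set U) (y z : E) : nbhs u N ->
  exists2 d : K, 0 < d & forall s t : K, `|s| < d -> `|t| < d ->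
    exists2 v : U, \val v = \val u + s *: y + t *: z & N v.
Proof.
move=> /nbhs_val[O uO ON].
have /(_ _) := @line_continuous (\val u) y z (0, 0) O.
rewrite /= !scale0r !addr0 => /(_ uO)[[A B] /= [/nbhs_ballP[d /= d0 dA]]].
move=> /nbhs_ballP[e /= e0 eB] AB.
have [m [m0 md me]] := pos_lower_bound d0 e0.
exists m => // s t sm tm.
apply: ON; apply: (AB (s, t)); split=> /=.
  by apply: dA; rewrite -ball_normE /= sub0r normrN; exact: lt_le_trans md.
by apply: eB; rewrite -ball_normE /= sub0r normrN; exact: lt_le_trans me.
Qed.

Lemma nbhs_line (u : U) (N : set U) (y : E) : nbhs u N ->
  exists2 d : K, 0 < d & forall t : K, `|t| < d ->
    exists2 v : U, \val v = \val u + t *: y & N v.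
Proof.
move=> /(@nbhs_plane _ _ y 0)[d d0 dN]; exists d => // t td.
have [v + Nv] := dN t t td td; rewrite scaler0 addr0 => vE.
by exists v.
Qed.

Section derivatives.
Context {F : lcsType K}.
Implicit Types h : U -> F.

Lemma extE h (u : U) : 'valL_0 h (\val u) = h u.
Proof. by rewrite /valL_ /= oinv_set_val valK. Qed.

Lemma dir_deriveE h y u : dir_derivable h y u ->
  diff_quotient h y u @ 0^' --> dir_derive h y u.
Proof.
by move=> hy; exact: (@xgetPex _ _ [set l | diff_quotient h y u @ 0^' --> l]).
Qed.

Lemma diff_quotient_cvgZ h y u a l :
  diff_quotient h y u @ 0^' --> l -> diff_quotient h (a *: y) u @ 0^' --> a *: l.
Proof.
move=> hl; have [->|a0] := eqVneq a 0.
  have -> : diff_quotient h (0 *: y) u = fun=> 0.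
    apply/funext => t; rewrite /diff_quotient scale0r scaler0 addr0.
    by rewrite extE subrr scaler0.
  by rewrite scale0r; exact: cvg_cst.
have -> : diff_quotient h (a *: y) u =
    fun t => (a : K^o) *: (diff_quotient h y u \o ( *%R^~ a)) t.
  apply/funext => t; rewrite /diff_quotient /= !scalerA; congr (_ *: _).
  by rewrite invfM mulrCA divff// mulr1.
apply: (@tvs_cvgZ _ _ _ _ (fun=> a)); first exact: cvg_cst.
apply: cvg_comp hl => A /near0P[d d0 dA]; apply/near0P.
exists (d / `|a|); first by rewrite divr_gt0 ?normr_gt0.
move=> t t0; rewrite ltr_pdivlMr ?normr_gt0// -normrM => ta.
by apply: dA => //; rewrite mulf_neq0.
Qed.

Lemma dir_derivableZ h y u a : dir_derivable h y u -> dir_derivable h (a *: y) u.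
Proof. by move=> [l hl]; exists (a *: l); exact: diff_quotient_cvgZ. Qed.

Lemma dir_deriveZ h y u a : dir_derivable h y u ->
  dir_derive h (a *: y) u = a *: dir_derive h y u.
Proof. by move=> /dir_deriveE hl; apply: dir_deriveP; exact: diff_quotient_cvgZ. Qed.

End derivatives.

(** Clearing the division by [t] gives the limit the shape of the bound in [mean_value], and bounds
    of this shape can be added. *)
Lemma scalar_dir_deriveP (h : U -> K^o) y u l :
  diff_quotient h y u @ 0^' --> l <->
  forall e : K, 0 < e -> exists2 d : K, 0 < d &
    forall t, t != 0 -> `|t| < d -> `|'valL_0 h (\val u + t *: y) - h u - t * l| <= `|t| * e.
Proof.
have q t : t != 0 -> `|'valL_0 h (\val u + t *: y) - h u - t * l| =
    `|t| * `|diff_quotient h y u t - l|.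
  move=> t0; rewrite -normrM mulrBr; congr `|_ - _|.
  rewrite /diff_quotient.
  by rewrite -[LHS](mulKf (invr_neq0 t0)) invrK; congr (_ * _).
rewrite scalar_cvgP; split=> h1 e e0.
  have /near0P[d d0 dP] := h1 e e0.
  by exists d => // t t0 td; rewrite q// ler_wpM2l// ltW// dP.
have e20 : 0 < e / 2 by rewrite divr_gt0.
have [d d0 dP] := h1 _ e20; apply/near0P; exists d => // t t0 td.
have := dP t t0 td; rewrite q// ler_pM2l ?normr_gt0// => /le_lt_trans; apply.
by rewrite ltr_pdivrMr// ltr_pMr// ltr1n.
Qed.
End open_subset.

Section mean_value.
Context {R : realType} {K : numFieldType} (sc : scalars R K).
Context {E : tvsType K} (U : set E).
Local Notation emb := (emb sc).
Local Notation re := (re sc).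

Lemma emb_norm r : `|emb r| = emb `|r|.
Proof.
have emb0 := rmorph0 emb; have [r0|r0] := leP 0 r.
  by rewrite !ger0_norm// -emb0 emb_le.
rewrite [in RHS]ltr0_norm// ler0_norm ?rmorphN// -emb0 emb_le; exact: ltW.
Qed.

Lemma emb_lt r s : (emb r < emb s) = (r < s).
Proof. by rewrite !lt_neqAle emb_le (inj_eq (fmorph_inj _)). Qed.

Lemma norm_re z : emb `|re z| <= `|z|.
Proof.
have := re_le_norm sc (- z); have := re_le_norm sc z.
have -> : re (- z) = - re z by rewrite -sub0r reB -(rmorph0 emb) re_emb sub0r.
by rewrite normrN; case: (ger0P (re z)).
Qed.

Lemma embP (k : K) : 0 <= k -> k = emb (re k).
Proof. by move=> k0; rewrite -{2}(ger0_norm k0) norm_emb ger0_norm. Qed.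

(** The parameter is real even when [K] is complex, since the mean value theorem lives on real
    segments; [emb] carries the increments back into [K]. *)
Definition is_path_derive (g : R -> K) (s : R) (D : K) :=
  forall e : K, 0 < e -> exists2 d : R, 0 < d & forall r : R, r != 0 -> `|r| < d ->
    `|g (s + r) - g s - emb r * D| <= emb `|r| * e.

(** A complex path need not attain its mean slope, so only an inequality survives. Comparing with
    [c] makes it measure the deviation from a prescribed increment. *)
Lemma path_mean_value (g : R -> K) (c M : K) :
  (forall s : R, 0 <= s <= 1 -> exists2 D, is_path_derive g s D & `|D - c| <= M) ->
  `|g 1 - g 0 - c| <= M.
Proof.
move=> H; pose A : K := g 1 - g 0 - c.
have [w w1 wA] := re_phase sc A.
(* By the choice of w, f has increment |A| over [0, 1]. *)
pose f s := re (w * (g s - emb s * c)).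
have fd (s : R) : 0 <= s <= 1 ->
    exists2 D : R, is_derive (s : R^o) (1 : R^o) (f : R^o -> R^o) (D : R^o) & emb D <= M.
  move=> /H[D' gD DM].
  pose D := re (w * (D' - c)); exists D; last first.
    by rewrite (le_trans (re_le_norm _ _))// normrM w1 mul1r.
  have cv : (fun t : R^o => t^-1 *: (((f : R^o -> R^o) \o shift (s : R^o))
      (t *: (1 : R^o)) - f s)) @ (0 : R^o)^' --> (D : R^o).
    apply/scalar_cvgP => e e0; apply/near0P.
    have e20 : 0 < emb (e / 2) by rewrite -(rmorph0 emb) emb_lt divr_gt0.
    have [d d0 dP] := gD _ e20; exists d => // t t0 td.
    have := dP t t0 td; set Q := (X in `|X| <= _) => le1.
    have key : f (t + s) - f s - t * D = re (w * Q).
      rewrite /f /D -re_embM -!reB [t + s]addrC; congr re.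
      by rewrite /Q rmorphD; ring.
    have key2 : `|f (t + s) - f s - t * D| <= `|t| * (e / 2).
      rewrite key -(emb_le sc) (le_trans (norm_re _))// normrM w1 mul1r.
      by rewrite rmorphM.
    rewrite [t *: _]mulr1 /= -[X in `|_ - X|](mulKf t0) -[_ *: _]/(_ * _) -mulrBr.
    rewrite normrM normfV ltr_pdivrMl ?normr_gt0//.
    rewrite (le_lt_trans key2)// ltr_pM2l ?normr_gt0//.
    by rewrite ltr_pdivrMr// ltr_pMr// ltr1n.
  apply: DeriveDef; first by apply/cvg_ex; exists D.
  exact: cvg_lim cv.
have /choice[df dfP] : forall s : R, exists D : R, 0 <= s <= 1 ->
    is_derive (s : R^o) (1 : R^o) (f : R^o -> R^o) (D : R^o) /\ emb D <= M.
  move=> s; case: (pselect (0 <= s <= 1)) => [/fd[D]|] ; first by exists D.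
  by exists 0.
have [||s] := @MVT R f df 0 1 ltr01.
- move=> s; rewrite in_itv /= => /andP[s0 s1].
  by have [|//] := dfP s; rewrite !ltW.
- apply: (@derivable_within_continuous R R^o f) => s; rewrite in_itv /= => s01.
  by have [[]] := dfP s s01.
rewrite in_itv /= subr0 mulr1 => /andP[s0 s1] fE.
have [|_ dfM] := dfP s; first by rewrite !ltW.
rewrite -wA (le_trans _ dfM)// emb_le -fE /f -reB -mulrBr.
by rewrite rmorph0 rmorph1 mul0r mul1r subr0 /A addrAC.
Qed.

Hypothesis hU : open U.

Lemma dir_path_derive (h : U -> K^o) (x y : E) (t : K) (u : U) (s : R) :
  \val u = x + (emb s * t) *: y -> dir_derivable h y u ->
  is_path_derive (fun s => 'valL_0 h (x + (emb s * t) *: y)) s (t * dir_derive h y u).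
Proof.
move=> ux hy e e0.
have /(dir_deriveZ t) := hy; have /(dir_derivableZ t)/dir_deriveE := hy.
move=> /scalar_dir_deriveP/(_ e e0)[d d0 dP] tE; rewrite {}tE in dP.
have [d' dE] : exists d', d = emb d' by exists (re d); exact/embP/ltW.
rewrite {}dE -{1}(rmorph0 emb) emb_lt in d0 dP.
exists d' => // r r0 rd; rewrite -emb_norm.
have := dP (emb r); rewrite fmorph_eq0 r0 emb_norm emb_lt => /(_ isT rd).
rewrite -(extE h u) ux.
have -> // : x + (emb (s + r) * t) *: y = x + (emb s * t) *: y + emb r *: (t *: y).
by rewrite scalerA -addrA -scalerDl -mulrDl -rmorphD.
Qed.

Lemma emb_segment (s : R) (t : K) : 0 <= s <= 1 -> `|emb s * t| <= `|t|.
Proof.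
move=> /andP[s0 s1]; rewrite normrM emb_norm (ger0_norm s0) ler_piMl//.
by rewrite -(rmorph1 emb) emb_le.
Qed.

Lemma mean_value (h : U -> K^o) (x y : E) (t c M : K) :
  (forall s : R, 0 <= s <= 1 -> exists u : U, [/\ \val u = x + (emb s * t) *: y,
     dir_derivable h y u & `|dir_derive h y u - c| <= M]) ->
  `|'valL_0 h (x + t *: y) - 'valL_0 h x - t * c| <= `|t| * M.
Proof.
move=> H; have := @path_mean_value (fun s => 'valL_0 h (x + (emb s * t) *: y))
  (t * c) (`|t| * M).
rewrite rmorph0 rmorph1 mul0r mul1r scale0r addr0; apply => s /H[u [ux hy uM]].
exists (t * dir_derive h y u); first exact: dir_path_derive.
by rewrite -mulrBr normrM ler_wpM2l.
Qed.

(** The increment along [y + z] is split at [\val u + t *: y]. The derivative at [u] handles the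
    step along [y]; the step along [z] starts away from [u] and needs the mean value inequality,
    hence continuity of [dir_derive h z]. *)
Lemma dir_deriveD (h : U -> K^o) (y z : E) (u : U) :
  dir_derivable h y u -> (forall v, dir_derivable h z v) ->
  {for u, continuous (dir_derive h z)} ->
  dir_derive h (y + z) u = dir_derive h y u + dir_derive h z u.
Proof.
move=> /dir_deriveE hy hz cz; apply: dir_deriveP.
apply/scalar_dir_deriveP => e e0.
have e20 : 0 < e / 2 by rewrite divr_gt0.
have /scalar_dir_deriveP/(_ _ e20)[d d0 dP] := hy.
have /scalar_cvgP/(_ _ e20) := cz.
move=> /(nbhs_plane hU y z)[d' d'0 d'P].
have [m [m0 md md']] := pos_lower_bound d0 d'0.
exists m => // t t0 tm.
have := dP t t0 (lt_le_trans tm md).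
have : `|'valL_0 h (\val u + t *: y + t *: z) - 'valL_0 h (\val u + t *: y) -
    t * dir_derive h z u| <= `|t| * (e / 2).
  apply: mean_value => s s01.
  have [||v vE vN] := d'P t (emb s * t).
  - exact: lt_le_trans md'.
  - exact: le_lt_trans (emb_segment _ s01) (lt_le_trans tm md').
  by exists v; split=> //; exact: ltW.
move=> le1 le2; have := lerD le1 le2; rewrite -mulrDr -splitr.
apply: le_trans; rewrite (le_trans _ (ler_normD _ _))// scalerDr addrA.
rewrite le_eqVlt; apply/orP; left; apply/eqP; congr `|_|; ring.
Qed.

(** The mean value inequality is used twice: for the path [g], whose derivative involves
    [dir_derive h z] at two points that differ by [t *: y], and then for that difference. Since the
    second difference is symmetric in [y] and [z], [schwarz] follows. *)
Lemma second_difference (h : U -> K^o) (y z : E) (u : U) :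
  (forall v, dir_derivable h z v) -> (forall v, dir_derivable (dir_derive h z) y v) ->
  {for u, continuous (dir_derive (dir_derive h z) y)} ->
  forall e : K, 0 < e -> exists2 d : K, 0 < d & forall t : K, `|t| < d ->
    `|'valL_0 h (\val u + t *: y + t *: z) - 'valL_0 h (\val u + t *: y)
       - 'valL_0 h (\val u + t *: z) + 'valL_0 h (\val u)
       - t * (t * dir_derive (dir_derive h z) y u)| <= `|t| * (`|t| * e).
Proof.
move=> hz hzy cyz e e0.
have /scalar_cvgP/(_ _ e0)/(nbhs_plane hU y z)[d d0 dP] := cyz.
exists d => // t td.
set c := dir_derive (dir_derive h z) y u.
pose g s := 'valL_0 h (\val u + t *: y + (emb s * t) *: z) -
            'valL_0 h (\val u + (emb s * t) *: z).
have := @path_mean_value g (t * (t * c)) (`|t| * (`|t| * e)).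
rewrite /g rmorph0 rmorph1 mul0r mul1r scale0r !addr0 => mv.
set Q := (X in `|X| <= _).
have -> : Q = 'valL_0 h (\val u + t *: y + t *: z) - 'valL_0 h (\val u + t *: z) -
    ('valL_0 h (\val u + t *: y) - 'valL_0 h (\val u)) - t * (t * c).
  by rewrite /Q; ring.
apply: mv => s s01.
have st : `|emb s * t| < d by exact: le_lt_trans (emb_segment _ s01) td.
have d0' : `|0 : K| < d by rewrite normr0.
have [v vE _] := dP _ _ td st; have [w wE _] := dP _ _ d0' st.
rewrite scale0r addr0 in wE.
exists (t * (dir_derive h z v - dir_derive h z w)).
  move=> e' e'0; have e20 : 0 < e' / 2 by rewrite divr_gt0.
  have [d1 d10 d1P] := dir_path_derive vE (hz v) e20.
  have [d2 d20 d2P] := dir_path_derive wE (hz w) e20.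
  exists (Num.min d1 d2); first by rewrite lt_min d10.
  move=> r r0; rewrite lt_min => /andP[/(d1P r r0) le1 /(d2P r r0) le2].
  rewrite [e']splitr [leRHS]mulrDr.
  apply: le_trans (lerD le1 le2); apply: le_trans (ler_normB _ _).
  rewrite le_eqVlt; apply/orP; left; apply/eqP; congr `|_|; ring.
rewrite -mulrBr normrM ler_wpM2l//.
rewrite -(extE (dir_derive h z) v) -(extE (dir_derive h z) w) vE wE [\val u + _ + _]addrAC.
apply: mean_value => r r01.
have rt : `|emb r * t| < d by exact: le_lt_trans (emb_segment _ r01) td.
have [v' v'E v'N] := dP _ _ rt st; exists v'; split=> //.
  by rewrite v'E addrAC.
exact: ltW.
Qed.

Lemma schwarz (h : U -> K^o) (y z : E) (u : U) :
  (forall x v, dir_derivable h x v) ->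
  (forall x x' v, dir_derivable (dir_derive h x) x' v) ->
  (forall x x', {for u, continuous (dir_derive (dir_derive h x) x')}) ->
  dir_derive (dir_derive h y) z u = dir_derive (dir_derive h z) y u.
Proof.
move=> h1 h2 h3; apply/eqP; rewrite -subr_eq0 -normr_eq0 -[_ == _]negbK.
apply/negP => n0; set D := (X in `|X|) in n0.
have D0 : 0 < `|D| by rewrite lt_neqAle eq_sym n0 normr_ge0.
(* Both mixed derivatives approximate the same second difference; two errors of a third of the norm
   of [D] cannot add up to that norm. *)
have e0 : 0 < `|D| / 3 by rewrite divr_gt0.
have [d1 d10 d1P] := second_difference (h1 z) (h2 z y) (h3 z y) e0.
have [d2 d20 d2P] := second_difference (h1 y) (h2 y z) (h3 y z) e0.
have [m [m0 md1 md2]] := pos_lower_bound d10 d20.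
have m20 : 0 < m / 2 by rewrite divr_gt0.
have mm : `|m / 2| < m by rewrite gtr0_norm// ltr_pdivrMr// ltr_pMr// ltr1n.
have := lerD (d1P _ (lt_le_trans mm md1)) (d2P _ (lt_le_trans mm md2)).
move=> /(le_trans (ler_normB _ _)).
rewrite [\val u + (m / 2) *: z + _]addrAC.
set Q := (X in `|X| <= _).
have alg (a b c d t x x' : K) : a - b - c + d - t * (t * x) -
    (a - c - b + d - t * (t * x')) = t * (t * (x' - x)) by ring.
have -> : Q = (m / 2) * ((m / 2) * D) by exact: alg.
have mp : 0 < `|m / 2| by rewrite normr_gt0 gt_eqF.
rewrite -!mulrDr (normrM (m / 2) (m / 2 * D)) (normrM (m / 2) D) !(ler_pM2l mp).
rewrite -[leLHS]mulr1 (ler_pM2l D0) -mulr2n -[leRHS]mulr_natl.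
by rewrite ler_pdivlMr// mul1r ler_nat.
Qed.

End mean_value.

(** Adjacent transpositions carry the head of one list to its place in the other; the prefix [pre]
    in the induction lets the remaining entries be treated with the same [P]. *)
Lemma swap_perm_invariant (T : eqType) (A : Type) (P : seq T -> A) :
  (forall a y z b, P (a ++ y :: z :: b) = P (a ++ z :: y :: b)) ->
  forall s t, perm_eq s t -> P s = P t.
Proof.
move=> sw.
have mv l : forall a y b, P (a ++ y :: l ++ b) = P (a ++ l ++ y :: b).
  elim: l => [//|x l IH] a y b /=.
  by rewrite sw -cat_rcons IH cat_rcons.
suff H s : forall pre t, perm_eq s t -> P (pre ++ s) = P (pre ++ t).
  by move=> s t; exact: (H s [::]).
elim: s => [|y s IH] pre t; first by rewrite perm_sym => /perm_nilP ->.
move=> st; have yt : y \in t by rewrite -(perm_mem st) mem_head.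
case/splitPr: yt st => l r; rewrite perm_sym perm_catC/= perm_cons perm_catC perm_sym => st.
by rewrite -mv -!cat_rcons (IH _ _ st).
Qed.

(** A tube lemma: it turns joint continuity of a scalar function into continuity for uniform
    convergence on compact sets, the topology of E'_c. *)
Lemma compact_near (K : numFieldType) (T X : topologicalType) (C : set T) (p0 : X)
    (phi : X * T -> K^o) (e : K) :
  compact C -> continuous phi -> 0 < e ->
  \forall p \near p0, forall z, C z -> `|phi (p, z) - phi (p0, z)| < e.
Proof.
move=> /compact_near_coveringP cC cphi e0.
apply: (cC X (nbhs p0) (fun p z => `|phi (p, z) - phi (p0, z)| < e)) => z0 Cz0.
have e20 : 0 < e / 2 by rewrite divr_gt0.
have /scalar_cvgP/(_ _ e20)[[A B] /= [pA zB] AB] := cphi (p0, z0).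
exists (B, A) => //= -[z p] /= [Bz Ap].
have h1 := AB (p, z) (conj Ap Bz).
have h2 := AB (p0, z) (conj (nbhs_singleton pA) Bz).
rewrite [e]splitr -(subrK (phi (p0, z0)) (phi (p, z))) -addrA.
by rewrite (le_lt_trans (ler_normD _ _))// ltrD// distrC.
Qed.

Lemma ptws_continuous (X : topologicalType) (I : Type) (T : topologicalType)
    (f : X -> {ptws I -> T}) :
  (forall i, continuous (fun p => f p i)) -> continuous f.
Proof.
move=> cf p; apply/cvg_sup => i A [_ [[B oB <-] Bp BA]].
have Bn : nbhs (f p i) B by exact: open_nbhs_nbhs.
suff: \forall q \near p, A (f q) by [].
by apply: (@filterS _ (nbhs p) _ _ _ _ (cf i p B Bn)) => q; exact: BA.
Qed.

Lemma ptws_proj_continuous (I : choiceType) (T : topologicalType) (i : I) :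
  continuous (fun f : {ptws I -> T} => f i).
Proof. exact: (@proj_continuous I (fun=> T) i). Qed.

Lemma pair_continuous (X S T : topologicalType) (f : X -> S) (g : X -> T) :
  continuous f -> continuous g -> continuous (fun p => (f p, g p)).
Proof.
move=> cf cg p A [[B C] /= [fB gC] BCA].
suff: \forall q \near p, A (f q, g q) by [].
near=> q; apply: BCA; split=> /=; near: q; [exact: cf|exact: cg].
Unshelve. all: by end_near. Qed.

(* A sequence of continuous maps is expressed by the continuity of [nth (cst 0) ys i]
   for all i: beyond the end this is the constant 0. *)
Lemma nth_map_continuous (K : numFieldType) (A : Type) (x0 : A)
    (X : topologicalType) (E : tvsType K) (g : A -> X -> E) (s : seq A) :
  (forall i, continuous (g (nth x0 s i))) ->
  forall i, continuous (nth (cst 0) [seq g x | x <- s] i).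
Proof.
move=> cg i; have [si|si] := ltnP i (size s); first by rewrite (nth_map x0).
by rewrite nth_default ?size_map//; exact: cst_continuous.
Qed.

(** * Iterated derivatives, and iterated differentials with values in E'_c *)

Section gateaux.
Context {K : numFieldType} {E : tvsType K} {F : lcsType K} (U : set E).
Implicit Types f : U -> F.

(** Continuity for fixed directions already yields symmetry and linearity of scalar derivatives, and
    it passes to [iter_derive f ys] by mere concatenation of lists. *)
Definition gateaux_smooth f :=
  (forall ys y x, dir_derivable (iter_derive f ys) y x) /\
  forall ys, continuous (iter_derive f ys).

Lemma iter_derive_cat f ys zs :
  iter_derive f (ys ++ zs) = iter_derive (iter_derive f ys) zs.
Proof. exact: foldl_cat. Qed.

Lemma iter_derive_rcons f ys y :
  iter_derive f (rcons ys y) = dir_derive (iter_derive f ys) y.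
Proof. by rewrite /iter_derive foldl_rcons. Qed.

Lemma gateaux_smooth_iter f ys : gateaux_smooth f -> gateaux_smooth (iter_derive f ys).
Proof.
move=> [df cf]; split=> [zs y x|zs]; first by rewrite -iter_derive_cat; exact: df.
by rewrite -iter_derive_cat; exact: cf.
Qed.

Lemma dmap_seq f (X : Type) (a : X -> U) (ys : seq (X -> E)) p :
  @dmap K E F U (size ys) f (a p, (fun i : 'I_(size ys) => nth (cst 0) ys i p)) =
  iter_derive f [seq y p | y <- ys] (a p).
Proof.
rewrite /dmap /=; congr (iter_derive _ _ _).
apply: (@eq_from_nth _ 0) => [|i]; first by rewrite size_codom size_map card_ord.
rewrite size_codom card_ord => iy; rewrite (nth_map (cst 0))//.
by rewrite codomE (nth_map (Ordinal iy)) ?size_enum_ord// nth_enum_ord.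
Qed.

Lemma dmap_point_continuous (X : topologicalType) (a : X -> U) (ys : seq (X -> E)) :
  continuous a -> (forall i, continuous (nth (cst 0) ys i)) ->
  continuous (fun p => (a p, (fun i : 'I_(size ys) => nth (cst 0) ys i p))
    : U * {ptws 'I_(size ys) -> E}).
Proof.
move=> ca cys; apply: pair_continuous => //.
by apply: ptws_continuous => i; exact: cys.
Qed.

(** The point and every direction may depend on a parameter, so that one statement serves constant,
    repeated and varying directions. *)
Lemma smooth_iter_continuous f (X : topologicalType) (a : X -> U) (ys : seq (X -> E)) :
  f \in @smooth K E F U -> continuous a -> (forall i, continuous (nth (cst 0) ys i)) ->
  continuous (fun p => iter_derive f [seq y p | y <- ys] (a p)).
Proof.
move=> /asboolP[_ _ /(_ (size ys)) df] ca cys.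
have -> : (fun p => iter_derive f [seq y p | y <- ys] (a p)) =
    @dmap K E F U (size ys) f \o
    (fun p => (a p, (fun i : 'I_(size ys) => nth (cst 0) ys i p))).
  by apply/funext => p; rewrite /= dmap_seq.
move=> p; apply: continuous_comp; last exact: df.
exact: dmap_point_continuous.
Qed.

Lemma smooth_gateaux f : f \in @smooth K E F U -> gateaux_smooth f.
Proof.
move=> sf; have /asboolP[_ df _] := sf; split=> // ys.
have := @smooth_iter_continuous f U id [seq cst y | y <- ys] sf.
have -> : (fun p => iter_derive f [seq y p | y <- [seq cst y | y <- ys]] p) = iter_derive f ys.
  by apply/funext => p; rewrite -map_comp map_id.
apply; first by move=> x; exact: cvg_id.
by apply: (nth_map_continuous (x0 := 0)) => i; exact: cst_continuous.
Qed.

End gateaux.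

Section scalar_gateaux.
Context {R : realType} {K : numFieldType} (sc : scalars R K).
Context {E : tvsType K} (U : set E) (hU : open U).
Implicit Types f : U -> K^o.

Lemma iter_derive_perm f ys zs : gateaux_smooth f -> perm_eq ys zs ->
  iter_derive f ys = iter_derive f zs.
Proof.
move=> gf; apply: swap_perm_invariant => a y z b.
have stepE x x' : iter_derive f (a ++ [:: x, x' & b]) =
    iter_derive (dir_derive (dir_derive (iter_derive f a) x) x') b.
  exact: foldl_cat.
apply: etrans (stepE y z) (etrans _ (esym (stepE z y))).
apply: (congr1 (fun g => iter_derive g b)).
have [h1 h2] := gateaux_smooth_iter a gf.
rewrite /=; apply/funext => u; apply: (schwarz sc hU).
- by move=> x v; exact: (h1 [::]).
- by move=> x x' v; exact: (h1 [:: x]).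
- by move=> x x'; exact: (h2 [:: x; x']).
Qed.

Lemma iter_derive_linear f (c : K) y z ys : gateaux_smooth f ->
  iter_derive f (c *: y + z :: ys) = c *: iter_derive f (y :: ys) + iter_derive f (z :: ys).
Proof.
move=> [df cf]; rewrite -[LHS]/(iter_derive (dir_derive f (c *: y + z)) ys).
rewrite -(@iter_deriveDZ _ _ _ _ c (dir_derive f y) (dir_derive f z)).
- apply: (congr1 (fun g => iter_derive g ys)); apply/funext => u.
  rewrite /= (dir_deriveD sc hU).
  + by rewrite dir_deriveZ//; exact: (df [::]).
  + by apply: dir_derivableZ => //; exact: (df [::]).
  + by move=> v; exact: (df [::]).
  + exact: (cf [:: z]).
- by move=> zs x u; exact: (df (y :: zs)).
- by move=> zs x u; exact: (df (z :: zs)).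
Qed.

Section smooth.
Variables (f : U -> K^o) (sf : f \in @smooth K E K^o U).

Lemma iter_derive_cont_lin ys x :
  (fun z => iter_derive f (z :: ys) x) \in @cont_lin K E.
Proof.
apply/asboolP; split=> [c y z|].
  by rewrite iter_derive_linear//; exact: smooth_gateaux.
pose zs := @id E :: [seq cst y | y <- ys].
have := @smooth_iter_continuous _ _ _ _ f E (cst x) zs sf (@cst_continuous _ _ _).
have -> : (fun p => iter_derive f [seq y p | y <- zs] (cst x p)) =
    fun z => iter_derive f (z :: ys) x.
  by apply/funext => p; rewrite /= -map_comp map_id.
apply=> -[|i] /=; first by move=> z; exact: cvg_id.
by apply: (nth_map_continuous (x0 := 0)) => k; exact: cst_continuous.
Qed.
End smooth.

(* The linear form z |-> d^(j+1) f(x, z, y_1, .., y_j); for smooth f the default value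
   of insubd is not used. *)
Definition iter_differential f (ys : seq E) (x : U) : dualc E :=
  insubd 0 (fun z => iter_derive f (z :: ys) x).

Lemma iter_differentialE f ys x z : f \in @smooth K E K^o U ->
  iter_differential f ys x z = iter_derive f (z :: ys) x.
Proof.
move=> sf; rewrite /iter_differential /insubd insubT//.
exact: iter_derive_cont_lin.
Qed.

Lemma differential_iter f x : differential f x = iter_differential f [::] x.
Proof. by []. Qed.

Lemma iter_differential_perm f ys zs : f \in @smooth K E K^o U -> perm_eq ys zs ->
  iter_differential f ys = iter_differential f zs.
Proof.
move=> sf yz; apply/funext => x; apply: dualcP => z; rewrite !iter_differentialE//.
by rewrite (@iter_derive_perm _ (z :: ys) (z :: zs)) ?perm_cons//; exact: smooth_gateaux.
Qed.

Lemma iter_differential_linear f (c : K) y z ys x : f \in @smooth K E K^o U ->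
  iter_differential f (c *: y + z :: ys) x =
  c *: iter_differential f (y :: ys) x + iter_differential f (z :: ys) x.
Proof.
move=> sf; have gf := smooth_gateaux sf; apply: dualcP => w; rewrite dualcD dualcZ.
have sw a : iter_derive f [:: w, a & ys] = iter_derive f [:: a, w & ys].
  by apply: iter_derive_perm => //; rewrite -(cat1s w) -(cat1s a) perm_catCA.
have E1 a : iter_differential f (a :: ys) x w = iter_derive f [:: a, w & ys] x.
  by rewrite -sw; exact: iter_differentialE.
apply: etrans (E1 _) (etrans _ (esym (congr2 (fun p q => c * p + q) (E1 y) (E1 z)))).
exact: (congr1 (fun g => g x) (iter_derive_linear c y z (w :: ys) gf)).
Qed.

Lemma iter_differentialDZ f g (c : K) ys x :
  f \in @smooth K E K^o U -> g \in @smooth K E K^o U ->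
  iter_differential (c *: f + g) ys x = c *: iter_differential f ys x + iter_differential g ys x.
Proof.
move=> sf sg; have [df _] := smooth_gateaux sf; have [dg _] := smooth_gateaux sg.
apply: dualcP => w; have [_ cl] := @smooth_submod_closed K E K^o U.
rewrite dualcD dualcZ (iter_differentialE ys x w (cl c f g sf sg)).
rewrite (iter_differentialE ys x w sf) (iter_differentialE ys x w sg).
by rewrite (iter_deriveDZ c _ df dg).
Qed.

Lemma iter_differential_continuous f (X : topologicalType) (a : X -> U)
    (ys : seq (X -> E)) : f \in @smooth K E K^o U -> continuous a ->
  (forall i, continuous (nth (cst 0) ys i)) ->
  continuous (fun p => iter_differential f [seq y p | y <- ys] (a p)).
Proof.
move=> sf ca cys p0 A /dualc_nbhsP[C [e [cC e0 eA]]].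
pose phi (q : X * E) := iter_derive f (q.2 :: [seq y q.1 | y <- ys]) (a q.1).
have cphi : continuous (phi : X * E -> K^o).
  pose zs : seq (X * E -> E) := snd :: [seq y \o fst | y <- ys].
  have -> : phi = fun q => iter_derive f [seq z q | z <- zs] (a q.1).
    by apply/funext => q; rewrite /phi /= -map_comp.
  apply: smooth_iter_continuous => //.
    by move=> q; apply: (@continuous_comp _ _ _ fst a); [exact: cvg_fst|exact: ca].
  case=> [|i] /=; first by move=> q; exact: cvg_snd.
  apply: (nth_map_continuous (x0 := cst 0)) => k q.
  by apply: (@continuous_comp _ _ _ fst); [exact: cvg_fst|exact: cys].
suff: \forall p \near p0, A (iter_differential f [seq y p | y <- ys] (a p)) by [].
have := compact_near p0 cC cphi e0; apply: filterS => p pP.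
apply: eA => z Cz; rewrite (iter_differentialE _ (a p0) z sf).
rewrite (iter_differentialE _ (a p) z sf) distrC.
exact: pP.
Qed.

(** Convergence in E'_c must be uniform for [z] in a compact set. The mean value inequality bounds
    the error by the variation of the next derivative on a short segment, and [compact_near] makes
    this uniform in [z]. *)
Lemma iter_differential_derive f ys y x : f \in @smooth K E K^o U ->
  diff_quotient (iter_differential f ys) y x @ 0^' --> iter_differential f (rcons ys y) x.
Proof.
move=> sf; have [df _] := smooth_gateaux sf.
move=> A /dualc_nbhsP[C [e [cC e0 eA]]].
have e20 : 0 < e / 2 by rewrite divr_gt0.
pose phi (q : U * E) := iter_derive f (q.2 :: rcons ys y) q.1.
have cphi : continuous (phi : U * E -> K^o).
  pose zs : seq (U * E -> E) := snd :: [seq cst z | z <- rcons ys y].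
  have -> : phi = fun q => iter_derive f [seq z q | z <- zs] q.1.
    by apply/funext => q; rewrite /phi /= -map_comp map_id.
  apply: smooth_iter_continuous => //; first by move=> q; exact: cvg_fst.
  case=> [|i] /=; first by move=> q; exact: cvg_snd.
  by apply: (nth_map_continuous (x0 := 0)) => k; exact: cst_continuous.
have /(nbhs_line hU y)[d d0 dP] := compact_near x cC cphi e20.
suff: \forall t \near (0 : K^o)^', A (diff_quotient (iter_differential f ys) y x t) by [].
apply/near0P; exists d => // t t0 td.
apply: eA => z Cz.
have [v vE _] := dP t td.
rewrite distrC /diff_quotient -vE extE.
rewrite (iter_differentialE (rcons ys y) x z sf).
rewrite -[X in `|X - _|]/(t^-1 * (iter_differential f ys v z - iter_differential f ys x z)).
rewrite (iter_differentialE ys v z sf) (iter_differentialE ys x z sf).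
have := @mean_value _ _ sc _ _ (iter_derive f (z :: ys)) (\val x) y t
  (iter_derive f (z :: rcons ys y) x) (e / 2).
rewrite -vE !extE => mv.
rewrite -[X in `|_ - X|](mulKf t0) -mulrBr normrM normfV ltr_pdivrMl ?normr_gt0//.
apply: (@le_lt_trans _ _ (`|t| * (e / 2))); last first.
  by rewrite ltr_pM2l ?normr_gt0// ltr_pdivrMr// ltr_pMr// ltr1n.
apply: mv => s s01.
have [|w wE wN] := dP (emb sc s * t).
  exact: le_lt_trans (emb_segment sc _ s01) td.
exists w; split; [by rewrite wE|exact: df|].
rewrite -iter_derive_rcons /=; apply/ltW; exact: (wN z Cz).
Qed.

End scalar_gateaux.

(** * The pairing of E'_c with E *)

Section pairing.
Context {R : realType} {K : numFieldType} (sc : scalars R K) {E : lcsType K}.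
Context (br : dualc E -> dualc E -> dualc E) (hE : lc_poisson R br).
Local Notation emb := (emb sc).
Local Notation re := (re sc).

(** This is beta of the overview; by [poisson_ad] the default value of [eta_inv] does not occur. *)
Definition pairing (l : dualc E) (x : E) : E := eta_inv (Defs.eta x \o br l).

Lemma pairingE l x (m : dualc E) : m (pairing l x) = br l m x.
Proof.
have [y yE] := poisson_ad hE x l.
have : Defs.eta (pairing l x) = Defs.eta x \o br l :> (dualc E -> K^o).
  apply: (@xgetPex _ 0 [set z | Defs.eta z = _ :> (dualc E -> K^o)]).
  by exists y; exact: esym yE.
by move/(congr1 (fun h => h m)).
Qed.

(** Injectivity of [eta] takes the place of the Hahn-Banach theorem; it allows identities in E to be
    tested against functionals. *)
Lemma dual_separates (x y : E) : (forall m : dualc E, m x = m y) -> x = y.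
Proof.
move=> xy; have [inj _] := poisson_eta hE; apply: inj.
by apply: dualcP => m; exact: xy.
Qed.

Lemma dualcB (m : dualc E) x y : m (x - y) = m x - m y.
Proof. exact: (linear_funB (@dualc_linear _ _ m)). Qed.

Lemma pairing_linearl x : linear (pairing ^~ x).
Proof.
move=> c l l'; apply: dual_separates => m.
have [[lin _] _ _] := poisson_lie hE.
by rewrite dualc_linear !pairingE (lin m c l l').
Qed.

Lemma pairing_linearr l : linear (pairing l).
Proof.
move=> c x y; apply: dual_separates => m.
by rewrite dualc_linear !pairingE dualc_linear.
Qed.

Lemma nbhs_lcsP (x : E) (A : set E) : nbhs x A <-> exists C e,
  [/\ compact C, 0 < e & [set y | forall m : dualc E, C m -> `|m x - m y| < e] `<=` A].
Proof.
have [_ op] := poisson_eta hE; split.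
  rewrite nbhsE => -[O [/op[B oB OB] Ox] OA].
  have : nbhs (Defs.eta x) B by apply: open_nbhs_nbhs; split => //; move: Ox; rewrite OB.
  move=> /dualc_nbhsP[C [e [cC e0 eB]]]; exists C, e; split=> // y yC.
  by apply: OA; rewrite OB; apply: eB.
move=> [C [e [cC e0 CA]]]; apply: filterS CA _.
have := dualc_nbhs_ball (Defs.eta x) cC e0; rewrite nbhsE => -[B [oB Bx] BC].
rewrite nbhsE; exists (@Defs.eta K E @^-1` B); last by move=> y /BC.
by split=> //; apply/op; exists B.
Qed.

Lemma nbhs_lcs_ball (x : E) (C : set (dualc E)) (e : K) : compact C -> 0 < e ->
  \forall y \near x, forall m : dualc E, C m -> `|m x - m y| < e.
Proof. by move=> cC e0; apply/nbhs_lcsP; exists C, e; split=> // y; exact. Qed.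

(** The compact set in the second argument of the bracket is the set [C] of functionals that defines
    a seminorm on E, and the target neighbourhood consists of the forms small on [M]. Hypocontinuity
    of [br] thus becomes uniformity of beta over [M]. *)
Lemma pairing_hypo (l0 : dualc E) (M : set E) (C : set (dualc E)) (e : K) :
  compact M -> compact C -> 0 < e ->
  \forall l \near l0, forall x m, M x -> C m ->
    `|m (pairing l0 x) - m (pairing l x)| < e.
Proof.
move=> cM cC e0; have [_ _ hyp] := poisson_hypo hE.
have W0 := dualc_nbhs_ball (0 : dualc E) cM e0.
have [V V0 VW] := hyp _ _ cC W0.
have [[lin _] _ _] := poisson_lie hE.
have /dualc_nbhsP[C' [e' [cC' e'0 eV]]] := V0.
have := dualc_nbhs_ball l0 cC' e'0.
apply: filterS => l Vl x m Mx Cm.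
have Vll : V (l0 - l).
  by apply: eV => y Cy; rewrite -[X in X - _]/(0 : K) sub0r normrN; exact: Vl.
have := VW _ _ Vll Cm x Mx.
rewrite !pairingE; have -> : (0 : dualc E) x = 0 by [].
have := lin m (-1) l l0; rewrite !scaleN1r [- l + _]addrC => ->.
by rewrite sub0r normrN dualcD addrC dualcZ mulN1r.
Qed.

(** By [pairingE] the point [x] is tested against the functionals [br l m] with [m] in [C]; they
    form a compact set because [br l] is continuous. *)
Lemma pairing_continuousr l : continuous (pairing l).
Proof.
move=> x A /nbhs_lcsP[C [e [cC e0 CA]]].
have [cbr _ _] := poisson_hypo hE.
have cC' : compact (br l @` C).
  by apply: continuous_compact => //; apply: continuous_subspaceT => m; exact: cbr.
suff: \forall y \near x, A (pairing l y) by [].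
have := nbhs_lcs_ball x cC' e0; apply: filterS => y yC; apply: CA => m Cm.
by rewrite !pairingE; apply: yC; exists m.
Qed.

Lemma pairing_continuousl x : continuous (pairing ^~ x).
Proof.
move=> l A /nbhs_lcsP[C [e [cC e0 CA]]].
suff: \forall l' \near l, A (pairing l' x) by [].
have := pairing_hypo l (@compact_set1 _ x) cC e0; apply: filterS => l' lC.
by apply: CA => m Cm; exact: lC.
Qed.

Section dual_sup.
Variables (C : set (dualc E)) (cC : compact C).

(** The seminorm of uniform convergence on [C], with values in [R] as the k_R-property demands;
    adjoining [0] keeps the supremum meaningful for empty [C]. *)
Definition dual_sup (v : E) : R := sup (0 |` [set re `|m v| | m in C]).

Let dual_sup_bounded v : has_ubound (0 |` [set re `|m v| | m in C]).
Proof.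
have [M M0 Mv] := dualc_bounded (Defs.eta v) cC; exists (re M).
have M0' : 0 <= re M by rewrite -(emb_le sc) rmorph0 -embP// ltW.
move=> _ [->//|[m Cm <-]].
by rewrite -(emb_le sc) norm_emb -embP ltW//; exact: Mv.
Qed.

Lemma norm_le_dual_sup v m : C m -> `|m v| <= emb (dual_sup v).
Proof.
move=> Cm; rewrite -(norm_emb sc) emb_le; apply: ub_le_sup => //.
by right; exists m.
Qed.

Lemma dual_sup_le v r : 0 <= r -> (forall m, C m -> `|m v| <= emb r) -> dual_sup v <= r.
Proof.
move=> r0 H; apply: ge_sup; first by exists 0; left.
by move=> _ [->//|[m Cm <-]]; rewrite -(emb_le sc) norm_emb; exact: H.
Qed.

Lemma dual_sup_ge0 v : 0 <= dual_sup v.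
Proof. by apply: ub_le_sup => //; left. Qed.

Lemma dual_sup_dist v w r : 0 <= r -> (forall m, C m -> `|m v - m w| <= emb r) ->
  `|dual_sup v - dual_sup w| <= r.
Proof.
suff H v' w' : 0 <= r -> (forall m, C m -> `|m v' - m w'| <= emb r) ->
    dual_sup v' <= dual_sup w' + r.
  move=> r0 vw; rewrite ler_norml; have := H _ _ r0 vw.
  have /(H _ _ r0) : forall m, C m -> `|m w - m v| <= emb r.
    by move=> m Cm; rewrite distrC; exact: vw.
  by move=> *; apply/andP; split; lra.
move=> r0 vw; apply: dual_sup_le; first by rewrite addr_ge0// dual_sup_ge0.
move=> m Cm; rewrite -(subrK (m w') (m v')) rmorphD addrC.
by rewrite (le_trans (ler_normD _ _))// lerD// ?vw// norm_le_dual_sup.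
Qed.

Lemma dual_sup_continuous x0 : continuous (fun x => dual_sup (x - x0) : R^o).
Proof.
move=> x; apply/scalar_cvgP => e e0.
have e20 : 0 < emb (e / 2) by rewrite -(rmorph0 emb) emb_lt divr_gt0.
have := nbhs_lcs_ball x cC e20; apply: filterS => y xy.
apply: (@le_lt_trans _ _ (e / 2)); last by rewrite ltr_pdivrMr// ltr_pMr// ltr1n.
apply: dual_sup_dist; first by rewrite ltW// divr_gt0.
by move=> m Cm; rewrite !dualcB opprB addrA subrK distrC ltW// xy.
Qed.

End dual_sup.
End pairing.

Lemma nbhs_open_prod (K : numFieldType) (E : tvsType K) (X : topologicalType)
    (U : set E) (hU : open U) (u : U) (x : X) (N : set (U * X)) : nbhs (u, x) N ->
  \forall p \near (\val u, x), exists2 v : U, \val v = p.1 & N (v, p.2).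
Proof.
move=> [[A B] /= [/(nbhs_val hU)[O uO OA] xB] ABN].
exists (O, B) => // -[w z] /= [/OA[v vw Av] Bz]; exists v => //.
exact: (ABN (v, z)).
Qed.

Lemma near_fst (S T : topologicalType) (x : S) (y : T) (P : S -> Prop) :
  (\forall z \near x, P z) -> \forall p \near (x, y), P p.1.
Proof.
move=> xP; exists (P, setT); first by split => //; exact: filterT.
by move=> p [].
Qed.

(** * From continuity on compact sets to continuity *)

Section kR.
Context {R : realType} {K : numFieldType} (sc : scalars R K) {E : lcsType K}.
Context (br : dualc E -> dualc E -> dualc E) (hE : lc_poisson R br).
Context (U : set E) (hU : open U).
Local Notation emb := (emb sc).

Lemma max0_dist (a b : R) : `|Num.max 0 a - Num.max 0 b| <= `|a - b|.
Proof.
have H (c d : R) : Num.max 0 c <= Num.max 0 d + `|c - d|.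
  have d1 : 0 <= Num.max 0 d by rewrite le_max lexx.
  have d2 : d <= Num.max 0 d by rewrite le_max lexx orbT.
  have := normr_ge0 (c - d); have := ler_norm (c - d).
  by rewrite ge_max; move=> *; apply/andP; split; lra.
rewrite ler_norml; have := H a b; have := H b a; rewrite (distrC b).
by move=> *; apply/andP; split; lra.
Qed.

(* Multiplied by a cut-off function supported in U, dual_sup (pairing (g p) (pr p) - v)
   extends to all of E * E; by hypocontinuity the extension is continuous on compact sets,
   so that the k_R-property applies. *)
Lemma pairing_continuous (g : U * E -> dualc E) (pr : E * E -> E) :
  continuous g -> continuous pr ->
  continuous (fun p : U * E => pairing br (g p) (pr (\val p.1, p.2))).
Proof.
move=> cg cpr p0.
set h := fun p : U * E => _.
case: p0 => u0 y0 A /(nbhs_lcsP hE)[C [e [cC e0 CA]]].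
have [D [d [cD d0 DU]]] := (nbhs_lcsP hE (\val u0) U).1 (open_nbhs_nbhs (conj hU (val_in u0))).
have [r rE] : exists r, d = emb r by exists (re sc d); exact/embP/ltW.
have [ep epE] : exists ep, e = emb ep by exists (re sc e); exact/embP/ltW.
rewrite {}rE -{1}(rmorph0 emb) emb_lt in d0 DU.
rewrite {}epE -{1}(rmorph0 emb) emb_lt in e0 CA.
pose q := dual_sup sc D; pose x0 := \val u0.
(* By the choice of [D] and [r], all [x] with [q (x - x0) < r] lie in [U]. The cut-off vanishes as
   soon as [q (x - x0)] reaches [r / 2], hence in a whole neighbourhood of each point outside [U],
   boundary points included. *)
pose phi x : R := Num.max 0 (r / 2 - q (x - x0)).
have cphi : continuous (phi : E -> R^o).
  move=> x; apply/scalar_cvgP => n n0.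
  have /scalar_cvgP/(_ _ n0) := @dual_sup_continuous _ _ sc _ _ hE _ cD x0 x.
  apply: filterS => y; apply: le_lt_trans; rewrite (le_trans (max0_dist _ _))//.
  by rewrite opprB addrA addrAC [r / 2 + _]addrC addrK addrC distrC.
pose s p : R := 'valL_0 (fun u : U => dual_sup sc C (h (u, p.2) - h (u0, y0))) p.1.
have sE u y : s (\val u, y) = dual_sup sc C (h (u, y) - h (u0, y0)).
  by rewrite /s /= oinv_set_val valK.
pose H p : R := phi p.1 * s p.
have cH : continuous (H : E * E -> R^o).
  apply: (poisson_kR hE).2 => L cL; apply/subspace_continuousP => -[x1 y1] Lp1.
  suff: H p @[p --> within L (nbhs (x1, y1))] --> (H (x1, y1) : R^o) by [].
  have [Ux1|nUx1] := pselect (U x1); last first.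
    have qr : r / 2 < q (x1 - x0).
      rewrite ltNge; apply/negP => qx; apply: nUx1; apply: DU => m Dm.
      rewrite distrC -dualcB; apply: le_lt_trans (norm_le_dual_sup sc cD _ Dm) _.
      rewrite emb_lt; apply: le_lt_trans qx _.
      by rewrite ltr_pdivrMr// ltr_pMr// ltr1n.
    have nearH : \forall p \near (x1, y1), H p = 0.
      have := @dual_sup_continuous _ _ sc _ _ hE _ cD x0 x1.
      have qr' : 0 < q (x1 - x0) - r / 2 by rewrite subr_gt0.
      move=> /scalar_cvgP/(_ _ qr') nq.
      have : \forall p \near (x1, y1), `|q (p.1 - x0) - q (x1 - x0)| < q (x1 - x0) - r / 2.
        exact: near_fst nq.
      apply: filterS => p.
      rewrite ltr_norml => /andP[qp _].
      by rewrite /H /phi max_l ?mul0r//; lra.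
    have H0 : H (x1, y1) = 0 by rewrite /H /phi max_l ?mul0r//=; lra.
    apply/scalar_cvgP => n n0; apply: cvg_within; move: nearH; apply: filterS => p ->.
    by rewrite H0 subr0 normr0.
  have [u1 u1E] := set_typeP Ux1; rewrite -{}u1E in Lp1 *.
  (* Two errors of [n / 4]: replacing [g p] by [g (u1, y1)] costs the first, uniformly over the
     compact image of [L] under [pr]; moving the argument of the then fixed map
     [pairing br (g (u1, y1))] costs the second. *)
  have cs : s p @[p --> within L (nbhs (\val u1, y1))] --> (s (\val u1, y1) : R^o).
    apply/scalar_cvgP => n n0.
    have n20 : 0 < emb (n / 4) by rewrite -(rmorph0 emb) emb_lt divr_gt0.
    have cM : compact (pr @` L).
      by apply: continuous_compact => //; exact: continuous_subspaceT.
    have n1 := cg (u1, y1) _ (pairing_hypo hE (g (u1, y1)) cM cC n20).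
    have {n1} /(nbhs_open_prod hU) n1 : \forall p \near (u1, y1),
      forall x m, (pr @` L) x -> C m ->
      `|m (pairing br (g (u1, y1)) x) - m (pairing br (g p) x)| < emb (n / 4).
      exact: n1.
    have c2 : continuous (pairing br (g (u1, y1)) \o pr).
      by move=> z; apply: continuous_comp; [exact: cpr|exact: (pairing_continuousr hE)].
    have n2 := c2 _ _ (nbhs_lcs_ball hE _ cC n20).
    have {}n2 : \forall p \near (\val u1, y1), forall m : dualc E, C m ->
       `|m (pairing br (g (u1, y1)) (pr (\val u1, y1))) - m (pairing br (g (u1, y1)) (pr p))|
          < emb (n / 4) by exact: n2.
    suff: \forall p \near (\val u1, y1), L p -> `|s p - s (\val u1, y1)| < n by [].
    move: n1 n2; apply: filterS2 => -[x y] [v vE vP] m2 Lxy; rewrite /= in vE vP; subst x.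
    rewrite !sE; apply: (@le_lt_trans _ _ (n / 2)); last first.
      by rewrite ltr_pdivrMr// ltr_pMr// ltr1n.
    apply: dual_sup_dist => //; first by rewrite ltW// divr_gt0.
    move=> m Cm; rewrite -dualcB opprB addrA subrK dualcB distrC.
    have prL : (pr @` L) (pr (\val v, y)) by exists (\val v, y).
    have := vP _ _ prL Cm; have := m2 _ Cm; rewrite /h /=.
    set a := m _; set b := m _; set c := m _ => ab bc.
    rewrite -(subrK b a) -addrA (le_trans (ler_normD _ _))//.
    have -> : n / 2 = n / 4 + n / 4 by lra.
    by rewrite rmorphD lerD// ltW.
  have cp : phi p.1 @[p --> within L (nbhs (\val u1, y1))] --> (phi (\val u1) : R^o).
    apply/scalar_cvgP => n n0; apply: cvg_within.
    have nphi : \forall z \near \val u1, `|phi z - phi (\val u1)| < n.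
      by have /scalar_cvgP/(_ _ n0) := cphi (\val u1).
    exact: (near_fst y1 nphi).
  exact: (@cvgM R^o _ _ _ _ _ _ _ cp cs).
have phi0 : phi x0 = r / 2.
  rewrite /phi subrr (_ : q 0 = 0) ?subr0 ?max_r ?ltW ?divr_gt0//.
  apply/le_anti; rewrite dual_sup_ge0// andbT; apply: dual_sup_le => // m _.
  by rewrite -(subrr x0) dualcB subrr normr0 rmorph0.
have s0 : s (x0, y0) = 0.
  rewrite sE subrr; apply/le_anti; rewrite dual_sup_ge0// andbT; apply: dual_sup_le => // m _.
  by rewrite -(subrr x0) dualcB subrr normr0 rmorph0.
(* Near [x0] the cut-off stays above [r / 4], half of its value at [x0], so a bound on [H] can be
   divided by it to bound [s]. *)
have r40 : 0 < r / 4 by rewrite divr_gt0.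
have n1 : \forall p \near (x0, y0), r / 4 < phi p.1.
  have /scalar_cvgP/(_ _ r40) := cphi x0; rewrite phi0 => n1.
  have := near_fst y0 n1; apply: filterS => p /=.
  by rewrite ltr_norml => /andP[+ _] => ?; lra.
have n2 : \forall p \near (x0, y0), `|H p| < r / 4 * (ep / 2).
  have re0 : 0 < r / 4 * (ep / 2) by rewrite mulr_gt0// divr_gt0.
  have /scalar_cvgP/(_ _ re0) := cH (x0, y0).
  by rewrite [H (x0, y0)]/H s0 mulr0; apply: filterS => p; rewrite subr0.
have n3 : \forall p \near (x0, y0), s p < ep / 2.
  move: n1 n2; apply: filterS2 => p p1 p2.
  have phip : 0 < phi p.1 by apply: lt_trans p1.
  rewrite ltNge; apply/negP => sp.
  have : r / 4 * (ep / 2) <= H p.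
    by rewrite ler_pM// ltW// divr_gt0.
  by move: p2; rewrite ltr_norml => /andP[_ p2]; rewrite leNgt p2.
have ci : continuous (fun p : U * E => (\val p.1, p.2)).
  apply: pair_continuous; last by move=> p; exact: cvg_snd.
  by move=> p; apply: (@continuous_comp _ _ _ fst); [exact: cvg_fst|exact: val_continuous].
suff: \forall p \near (u0, y0), A (h p) by [].
have := ci (u0, y0) _ n3.
move=> n4; have {}n4 : \forall p \near (u0, y0), s (\val p.1, p.2) < ep / 2 by exact: n4.
move: n4; apply: filterS => -[u y]; rewrite sE /= => sep; apply: CA => m Cm.
rewrite distrC -dualcB; apply: le_lt_trans (norm_le_dual_sup sc cC _ Cm) _.
by rewrite emb_lt (lt_trans sep)// ltr_pdivrMr// ltr_pMr// ltr1n.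
Qed.

End kR.

(** * The derivatives of the Hamiltonian vector field *)

Section diff_quotient_rules.
Context {K : numFieldType} {E : tvsType K} {F : lcsType K} (U : set E) (hU : open U).

Lemma diff_quotient_cvgD (f g : U -> F) y x (l m : F) :
  diff_quotient f y x @ 0^' --> l -> diff_quotient g y x @ 0^' --> m ->
  diff_quotient (fun x => f x + g x) y x @ 0^' --> l + m.
Proof.
move=> fl gm; have := @diff_quotient_cvgDZ _ _ _ _ 1 _ _ _ _ _ _ fl gm.
by rewrite !scale1r.
Qed.

Lemma diff_quotient0 y x : diff_quotient (fun _ : U => 0 : F) y x @ 0^' --> (0 : F).
Proof.
rewrite (_ : diff_quotient _ _ _ = fun=> 0); first exact: cvg_cst.
apply/funext => t; rewrite /diff_quotient /=.
by case: ('oinv_set_val _) => [z|] /=; rewrite subr0 scaler0.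
Qed.

Lemma diff_quotient_comp {G : lcsType K} (L : F -> G) (g : U -> F) y x t :
  linear L -> diff_quotient (L \o g) y x t = L (diff_quotient g y x t).
Proof.
move=> lL; rewrite /diff_quotient (linear_funZ lL) (linear_funB lL); congr (_ *: (_ - _)).
rewrite /valL_ /=; case: ('oinv_set_val _) => //=; exact/esym/linear_fun0.
Qed.

End diff_quotient_rules.

Section leibniz.
Context {R : realType} {K : numFieldType} (sc : scalars R K) {E : lcsType K}.
Context (br : dualc E -> dualc E -> dualc E) (hE : lc_poisson R br).
Context (U : set E) (hU : open U).
Local Notation pairing := (pairing br).

Lemma diff_quotient_pairing (g : U -> dualc E) y x l z :
  diff_quotient g y x @ 0^' --> l ->
  diff_quotient (fun x => pairing (g x) z) y x @ 0^' --> pairing l z.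
Proof.
move=> gl.
rewrite (_ : diff_quotient _ _ _ = (pairing ^~ z) \o diff_quotient g y x).
  by apply: continuous_cvg gl; exact: (pairing_continuousl hE).
by apply/funext => t; exact: (@diff_quotient_comp _ _ _ _ _ (pairing ^~ z) g y x t
  (pairing_linearl hE z)).
Qed.

(** With [g] at the displaced point written as [t *: Q t + g x], bilinearity leaves one mixed term
    [t *: pairing (Q t) y], which tends to 0. Joint continuity of beta is thereby avoided:
    continuity in the first argument controls all limits. *)
Lemma diff_quotient_pairing_val (g : U -> dualc E) y x l :
  diff_quotient g y x @ 0^' --> l ->
  diff_quotient (fun x => pairing (g x) (\val x)) y x @ 0^' -->
    pairing l (\val x) + pairing (g x) y.
Proof.
move=> gl; pose Q := diff_quotient g y x.
have lin1 := pairing_linearl hE; have lin2 := pairing_linearr hE.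
have Qv v : (pairing ^~ v \o Q) @ 0^' --> pairing l v.
  by apply: continuous_cvg gl; exact: (pairing_continuousl hE).
have lim : (fun t : K^o => pairing (Q t) (\val x) + pairing (g x) y + t *: pairing (Q t) y)
    @ 0^' --> pairing l (\val x) + pairing (g x) y.
  rewrite -[X in _ --> X]addr0 -(scale0r (pairing l y)).
  apply: tvs_cvgD; first by apply: tvs_cvgD; [exact: Qv|exact: cvg_cst].
  apply: (@tvs_cvgZ _ _ _ _ (fun t : K^o => t)); last exact: Qv.
  by apply: cvg_within_filter; exact: cvg_id.
apply: cvg_trans lim; apply: near_eq_cvg; apply/near0P.
have [d d0 dP] := nbhs_line hU y (@filterT _ (nbhs x) _).
exists d => // t t0 td; have [v vE _] := dP t td.
have gv : g v = t *: Q t + g x.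
  by rewrite /Q /diff_quotient -vE extE scalerA divff// scale1r subrK.
rewrite /diff_quotient -vE extE gv vE [\val x + _]addrC.
rewrite (lin2 _ t y (\val x)) (lin1 _ t (Q t) (g x)) (lin1 _ t (Q t) (g x)).
rewrite addrA addrK !scalerDr !scalerA !mulVf// mul1r !scale1r.
by rewrite addrC addrA addrAC.
Qed.

(** The sum over i of beta(Gam(ys without y_i), y_i): each entry passed by the recursion is put back
    in front of the argument of [Gam]. *)
Fixpoint leibniz_sum (Gam : seq E -> dualc E) (ys : seq E) : E :=
  if ys is y :: ys' then
    pairing (Gam ys') y + leibniz_sum (fun r => Gam (y :: r)) ys'
  else 0.

Lemma leibniz_sum_rcons Gam ys y :
  leibniz_sum Gam (rcons ys y) =
  leibniz_sum (fun r => Gam (rcons r y)) ys + pairing (Gam ys) y.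
Proof.
elim: ys Gam => [|z ys IH] Gam /=; first by rewrite addrC.
by rewrite IH addrA.
Qed.

Lemma leibniz_sum_perm Gam ys zs : (forall r r', perm_eq r r' -> Gam r = Gam r') ->
  perm_eq ys zs -> leibniz_sum Gam ys = leibniz_sum Gam zs.
Proof.
move=> pGam yz.
pose P (s : seq E) (H : {H : seq E -> dualc E | forall r r', perm_eq r r' -> H r = H r'}) :=
  leibniz_sum (sval H) s.
suff PP : P ys = P zs by exact: (congr1 (fun h => h (exist _ Gam pGam)) PP).
apply: (@swap_perm_invariant _ _ P) yz => a y z b; apply/funext => -[H pH].
rewrite /P /= {P Gam pGam}.
elim: a H pH => [|x a IH] Gam pG /=.
  rewrite addrCA; congr (_ + (_ + leibniz_sum _ _)).
  by apply/funext => r; apply: pG; rewrite -(cat1s y) -(cat1s z) perm_catCA.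
congr (pairing _ _ + _).
  by apply: pG; rewrite perm_cat2l -(cat1s y) -(cat1s z) perm_catCA.
by apply: IH => r r' rr; apply: pG; rewrite perm_cons.
Qed.

Lemma leibniz_sum_linear c (G1 G2 : seq E -> dualc E) ys :
  leibniz_sum (fun r => c *: G1 r + G2 r) ys = c *: leibniz_sum G1 ys + leibniz_sum G2 ys.
Proof.
elim: ys G1 G2 => [|y ys IH] G1 G2 /=; first by rewrite scaler0 addr0.
by rewrite IH (pairing_linearl hE) scalerDr addrACA.
Qed.

Lemma leibniz_sum_nseq Gam n y :
  leibniz_sum Gam (nseq n.+1 y) = n.+1%:R *: pairing (Gam (nseq n y)) y.
Proof.
elim: n Gam => [|n IH] Gam; first by rewrite /= addr0 scale1r.
rewrite -[LHS]/(pairing (Gam (nseq n.+1 y)) y +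
  leibniz_sum (fun r => Gam (y :: r)) (nseq n.+1 y)) IH.
by rewrite -[in RHS]natr1 scalerDl scale1r addrC.
Qed.

Lemma diff_quotient_leibniz_sum (Gam : seq E -> U -> dualc E) (Lam : seq E -> dualc E) y x ys :
  (forall r, diff_quotient (Gam r) y x @ 0^' --> Lam r) ->
  diff_quotient (fun x => leibniz_sum (fun r => Gam r x) ys) y x @ 0^' --> leibniz_sum Lam ys.
Proof.
elim: ys Gam Lam => [|z ys IH] Gam Lam GL /=; first exact: diff_quotient0.
apply: (@diff_quotient_cvgD _ _ _ _ (fun x => pairing (Gam ys x) z)).
  exact: diff_quotient_pairing.
by apply: (IH (fun r => Gam (z :: r))) => r; exact: GL.
Qed.

Section iterated.
Variables (f : U -> K^o) (sf : f \in @smooth K E K^o U).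
Local Notation G := (iter_differential f).

Definition hamiltonian_derive (ys : seq E) (x : U) : E :=
  pairing (G ys x) (\val x) + leibniz_sum (fun r => G r x) ys.

Lemma hamiltonian_derive0 : hamiltonian br f = hamiltonian_derive [::].
Proof.
apply/funext => x; rewrite /hamiltonian_derive /= addr0 -differential_iter.
by [].
Qed.

Lemma hamiltonian_derive_cvg ys y x :
  diff_quotient (hamiltonian_derive ys) y x @ 0^' --> hamiltonian_derive (rcons ys y) x.
Proof.
have dG r : diff_quotient (G r) y x @ 0^' --> G (rcons r y) x.
  exact: (iter_differential_derive sc hU).
(* The summand [pairing (G ys x) y] split off here is the second term of the product rule for
   [pairing (G ys x) (\val x)]. *)
rewrite /hamiltonian_derive leibniz_sum_rcons addrA addrAC.
apply: diff_quotient_cvgD; first exact: diff_quotient_pairing_val.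
exact: (@diff_quotient_leibniz_sum G (fun r => G (rcons r y) x)).
Qed.

Lemma iter_derive_hamiltonian ys :
  iter_derive (hamiltonian br f) ys = hamiltonian_derive ys.
Proof.
elim/last_ind: ys => [|ys y IH]; first exact: hamiltonian_derive0.
rewrite iter_derive_rcons IH; apply/funext => x.
by apply: dir_deriveP; exact: hamiltonian_derive_cvg.
Qed.

Lemma hamiltonian_derivable ys y x : dir_derivable (iter_derive (hamiltonian br f) ys) y x.
Proof.
rewrite iter_derive_hamiltonian; exists (hamiltonian_derive (rcons ys y) x).
exact: hamiltonian_derive_cvg.
Qed.

Lemma hamiltonian_derive_perm ys zs x : perm_eq ys zs ->
  hamiltonian_derive ys x = hamiltonian_derive zs x.
Proof.
move=> yz; rewrite /hamiltonian_derive (iter_differential_perm sc hU sf yz).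
apply: (congr1 (fun s => pairing (G zs x) (\val x) + s)).
apply: leibniz_sum_perm yz => r r' rr.
by rewrite (iter_differential_perm sc hU sf rr).
Qed.

Lemma hamiltonian_derive_linear c y z ys x :
  hamiltonian_derive (c *: y + z :: ys) x =
  c *: hamiltonian_derive (y :: ys) x + hamiltonian_derive (z :: ys) x.
Proof.
have GL r : G (c *: y + z :: r) x = c *: G (y :: r) x + G (z :: r) x.
  exact: (iter_differential_linear sc hU).
have collect (a1 a2 b1 b2 : E) : (c *: a1 + a2) + (c *: b1 + b2) = c *: (a1 + b1) + (a2 + b2).
  by rewrite scalerDr addrACA.
apply: etrans (congr2 +%R _ _) (collect _ _ _ _).
  by rewrite GL; exact: (pairing_linearl hE).
apply: etrans (congr2 +%R (pairing_linearr hE (G ys x) c y z) _) (collect _ _ _ _).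
apply: etrans (leibniz_sum_linear c (fun r => G (y :: r) x) (fun r => G (z :: r) x) ys).
by apply: (congr1 (fun H => leibniz_sum H ys)); apply/funext.
Qed.

Lemma hamiltonian_derive_diag_continuous n :
  continuous (fun p : U * E => hamiltonian_derive (nseq n p.2) p.1).
Proof.
have cG k : continuous (fun p : U * E => G (nseq k p.2) p.1).
  have -> : (fun p : U * E => G (nseq k p.2) p.1) =
      fun p => G [seq y p | y <- nseq k snd] p.1.
    by apply/funext => p; rewrite map_nseq.
  apply: (iter_differential_continuous sc hU sf); first by move=> p; exact: cvg_fst.
  move=> i; rewrite nth_nseq; case: ifP => _; first by move=> p; exact: cvg_snd.
  exact: cst_continuous.
(* The parameter [pr] of [pairing_continuous] selects the argument of beta in E: the point in this
   leading term, the direction in the sum below. *)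
have c1 : continuous (fun p : U * E => pairing (G (nseq n p.2) p.1) (\val p.1)).
  by apply: (pairing_continuous sc hE hU (cG n) (pr := fst)) => p; exact: cvg_fst.
case: n c1 => [|n] c1.
  rewrite (_ : (fun p => _) = (fun p : U * E => pairing (G (nseq 0 p.2) p.1) (\val p.1)))//.
  by apply/funext => p; rewrite /hamiltonian_derive /= addr0.
move=> p; rewrite /hamiltonian_derive.
apply: tvs_cvgD; first exact: c1.
have -> : (fun p : U * E => leibniz_sum (fun r => G r p.1) (nseq n.+1 p.2)) =
   (fun p : U * E => n.+1%:R *: pairing (G (nseq n p.2) p.1) p.2).
  by apply/funext => q; rewrite leibniz_sum_nseq.
rewrite leibniz_sum_nseq.
apply: (@tvs_cvgZ _ _ _ _ (fun=> n.+1%:R)); first exact: cvg_cst.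
by apply: (pairing_continuous sc hE hU (cG n) (pr := snd)) => q; exact: cvg_snd.
Qed.

End iterated.
End leibniz.

(** * Polarization *)

Lemma continuousDZ (K : numFieldType) (F : tvsType K) (X : topologicalType) (c : K)
    (f g : X -> F) :
  continuous f -> continuous g -> continuous (fun p => c *: f p + g p).
Proof.
move=> cf cg p; apply: tvs_cvgD; last exact: cg.
by apply: (@tvs_cvgZ _ _ _ _ (fun=> c : K^o)); [exact: cvg_cst|exact: cf].
Qed.

(* If Q_t = \sum_b t^b c_b, then Q_{2t} - 2^n Q_t has lost its term of degree n. *)
Lemma coef_continuous (K : numFieldType) (F : tvsType K) (X : topologicalType) n
    (c : nat -> X -> F) :
  (forall t : K, continuous (fun p => \sum_(b < n) t ^+ b *: c b p)) ->
  forall b, (b < n)%N -> continuous (c b).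
Proof.
elim: n c => [//|n IH] c cQ.
have cn b : (b < n)%N -> continuous (c b).
  move=> bn.
  have d0 : 2 ^+ b - 2 ^+ n != 0 :> K.
    by rewrite -!natrX subr_eq0 eqr_nat eqn_exp2l// neq_ltn bn.
  have cd : continuous (fun p => (2 ^+ b - 2 ^+ n : K) *: c b p).
    apply: (IH (fun b p => (2 ^+ b - 2 ^+ n : K) *: c b p)) => // t.
    have -> : (fun p => \sum_(b < n) t ^+ b *: ((2 ^+ b - 2 ^+ n : K) *: c b p)) =
        (fun p => (- 2 ^+ n) *: (\sum_(b < n.+1) t ^+ b *: c b p) +
           \sum_(b < n.+1) (2 * t) ^+ b *: c b p).
      apply/funext => p; rewrite !big_ord_recr /= scalerDr addrACA.
      rewrite scaler_sumr -big_split /= !scalerA -scalerDl exprMn mulNr addNr scale0r addr0.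
      apply: eq_bigr => i _; rewrite !scalerA -scalerDl exprMn; congr (_ *: _); ring.
    exact: continuousDZ.
  have -> : c b = (fun p => (2 ^+ b - 2 ^+ n : K)^-1 *: ((2 ^+ b - 2 ^+ n : K) *: c b p) + 0).
    by apply/funext => p; rewrite scalerA mulVf// scale1r addr0.
  by apply: continuousDZ => //; exact: cst_continuous.
move=> b; rewrite ltnS leq_eqVlt => /predU1P[->|]; last exact: cn.
(* The top coefficient is what the lower ones leave of the value at [t = 1]. *)
have -> : c n = (fun p => (-1) *: (\sum_(b < n) c b p) + \sum_(b < n.+1) 1 ^+ b *: c b p).
  apply/funext => p; rewrite big_ord_recr /= expr1n scale1r scaleN1r.
  have -> : \sum_(i < n) 1 ^+ i *: c i p = \sum_(i < n) c i p.
    by apply: eq_bigr => i _; rewrite expr1n scale1r.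
  by rewrite addKr.
apply: continuousDZ => //.
have : forall k, (k <= n)%N -> continuous (fun p => \sum_(b < k) c b p).
  elim=> [|k IHk] kn.
    rewrite (_ : (fun p => _) = cst 0); first exact: cst_continuous.
    by apply/funext => p; rewrite big_ord0.
  rewrite (_ : (fun p => _) = (fun p => 1 *: c k p + \sum_(b < k) c b p)).
    by apply: continuousDZ; [exact: cn|exact: IHk (ltnW kn)].
  by apply/funext => p; rewrite big_ord_recr /= scale1r addrC.
exact.
Qed.

Section polarization.
Context {K : numFieldType} {E F : tvsType K} {V : topologicalType}.
Variable T : seq E -> V -> F.
Hypothesis T_perm : forall ys zs x, perm_eq ys zs -> T ys x = T zs x.
Hypothesis T_linear : forall c y z ys x,
  T (c *: y + z :: ys) x = c *: T (y :: ys) x + T (z :: ys) x.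
Hypothesis T_diag : forall n, continuous (fun p : V * E => T (nseq n p.2) p.1).

(* The coefficients of T(t y + z, .., t y + z, w) as a polynomial in t. *)
Fixpoint polar_coef (y z : E) (x : V) (n b : nat) (w : seq E) : F :=
  match n, b with
  | 0, 0 => T w x
  | 0, _.+1 => 0
  | n.+1, 0 => polar_coef y z x n 0 (z :: w)
  | n.+1, b.+1 => polar_coef y z x n b.+1 (z :: w) + polar_coef y z x n b (y :: w)
  end.

Lemma polar_coef_eq0 y z x n b w : (n < b)%N -> polar_coef y z x n b w = 0.
Proof.
elim: n b w => [|n IH] [|b] w //= nb; rewrite !IH ?addr0//.
by rewrite ltnW.
Qed.

Lemma polar_coef_sum y z x n w (t : K) :
  T (nseq n (t *: y + z) ++ w) x = \sum_(b < n.+1) t ^+ b *: polar_coef y z x n b w.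
Proof.
elim: n w => [|n IH] w; first by rewrite big_ord_recr big_ord0 /= add0r scale1r.
rewrite /= T_linear.
have mv v : perm_eq (v :: nseq n (t *: y + z) ++ w) (nseq n (t *: y + z) ++ v :: w).
  by rewrite -cat1s -(cat1s v w) perm_catCA.
rewrite (T_perm _ (mv y)) (T_perm _ (mv z)) !IH.
rewrite [RHS]big_ord_recl /= expr0 scale1r.
rewrite [in LHS]addrC [X in X + _]big_ord_recl /= expr0 scale1r -addrA; congr (_ + _).
rewrite [RHS](eq_bigr (fun i : 'I_n.+1 => t ^+ i.+1 *: polar_coef y z x n i.+1 (z :: w) +
  t ^+ i.+1 *: polar_coef y z x n i (y :: w))); last first.
  by move=> i _; rewrite /bump !leq0n !add1n /= scalerDr.
rewrite big_split /=; congr (_ + _).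
  by rewrite [RHS]big_ord_recr /= polar_coef_eq0// scaler0 addr0.
by rewrite scaler_sumr; apply: eq_bigr => i _; rewrite scalerA -exprS.
Qed.

Lemma polar_coef0 y z x n w : polar_coef y z x n 0 w = T (nseq n z ++ w) x.
Proof.
elim: n w => [//|n IH] w; rewrite /= IH; apply: T_perm.
by rewrite -[X in perm_eq _ X]cat1s -(cat1s z w) perm_catCA.
Qed.

Lemma polar_coef1 y z x n w :
  polar_coef y z x n.+1 1 w = n.+1%:R *: T (nseq n z ++ y :: w) x.
Proof.
elim: n w => [|n IH] w; first by rewrite /= add0r scale1r.
rewrite -[LHS]/(polar_coef y z x n.+1 1 (z :: w) + polar_coef y z x n.+1 0 (y :: w)).
rewrite IH polar_coef0 -[in RHS]natr1 scalerDl scale1r; congr (_ *: _ + _).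
apply: T_perm; rewrite -(cat1s z) -(cat1s y) catA perm_sym.
rewrite -[nseq n.+1 z]/([:: z] ++ nseq n z) -catA perm_catCA perm_sym -catA.
by rewrite perm_cat2l perm_catCA.
Qed.

(** By [polar_coef1], putting [y] beside [n] copies of [z] gives, up to the factor [n.+1], the
    linear coefficient in [t] of the value at [n.+1] copies of [t *: y + z]. Each direction is thus
    traded for one more repetition, which is why the induction on [ys] keeps [n] and [z] arbitrary
    and ends on the diagonal. *)
Lemma polarization_continuous (X : topologicalType) (a : X -> V) (ys : seq (X -> E)) :
  continuous a -> (forall i, continuous (nth (cst 0) ys i)) ->
  continuous (fun p => T [seq y p | y <- ys] (a p)).
Proof.
move=> ca cys.
suff H : forall n (z : X -> E), continuous z ->
    continuous (fun p => T (nseq n (z p) ++ [seq y p | y <- ys]) (a p)).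
  by apply: (H 0 (cst 0)); exact: cst_continuous.
elim: ys cys => [|y ys IH] cys n z cz.
  have -> : (fun p => T (nseq n (z p) ++ [seq y p | y <- [::]]) (a p)) =
     (fun p : V * E => T (nseq n p.2) p.1) \o (fun p => (a p, z p)).
    by apply/funext => p; rewrite /= cats0.
  move=> p; apply: continuous_comp; last exact: T_diag.
  exact: pair_continuous.
have cy : continuous y := cys 0.
have {}IH := IH (fun i => cys i.+1).
pose c b p := polar_coef (y p) (z p) (a p) n.+1 b [seq y p | y <- ys].
have cc : forall b, (b < n.+2)%N -> continuous (c b).
  apply: coef_continuous => t.
  have -> : (fun p => \sum_(b < n.+2) t ^+ b *: c b p) =
      fun p => T (nseq n.+1 (t *: y p + z p) ++ [seq y p | y <- ys]) (a p).
    by apply/funext => p; rewrite polar_coef_sum.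
  by apply: (IH n.+1 (fun p => t *: y p + z p)); exact: continuousDZ.
have -> : (fun p => T (nseq n (z p) ++ [seq y p | y <- y :: ys]) (a p)) =
    fun p => n.+1%:R^-1 *: c 1 p + 0.
  apply/funext => p; rewrite /c polar_coef1 scalerA mulVf ?scale1r ?addr0//.
  by rewrite pnatr_eq0.
by apply: continuousDZ; [exact: cc|exact: cst_continuous].
Qed.

End polarization.

(** * The compact-open C^oo-topology *)

Section Cinf_topology.
Context {K : numFieldType} {E : tvsType K} {F : lcsType K} (U : set E).

Lemma Cinf_dmap_continuous j : continuous (@Cinf_dmap K E F U j).
Proof.
move=> f A fA.
have : (nbhs f : set_system (Cinf F U)) --> f by exact: cvg_id.
move=> /cvg_sup/(_ j); apply.
exact: (@initial_continuous _ _ (@Cinf_dmap K E F U j) f A fA).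
Qed.

Lemma Cinf_cvg (T : Type) (G : set_system T) (h : T -> Cinf F U) (f : Cinf F U) :
  Filter G ->
  (forall j, (fun x => @Cinf_dmap K E F U j (h x)) @ G --> @Cinf_dmap K E F U j f) ->
  h @ G --> f.
Proof.
move=> FG hf; apply/cvg_sup => j A [_ [[B oB <-] Bf] BA].
have : nbhs (@Cinf_dmap K E F U j f) B by exact: open_nbhs_nbhs.
move=> /(hf j) GB; suff: \forall x \near G, A (h x) by [].
have : \forall x \near G, B (@Cinf_dmap K E F U j (h x)) by exact: GB.
by apply: filterS => x; exact: BA.
Qed.

Lemma Cinf_val_smooth (f : Cinf F U) : (f : U -> F) \in @smooth K E F U.
Proof. exact: valP. Qed.

End Cinf_topology.

(** At a continuous map, compact-open convergence is uniform convergence on compact sets; smoothness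
    of [f0] supplies the continuity. *)
Lemma Cinf_dmap_near (K : numFieldType) (E : tvsType K) (U : set E) j (f0 : Cinf K^o U)
    (Q : set (U * {ptws 'I_j -> E})) (e : K) : compact Q -> 0 < e ->
  \forall f \near f0, forall p, Q p ->
    `|@dmap K E K^o U j f0 p - @dmap K E K^o U j (f : Cinf K^o U) p| < e.
Proof.
move=> cQ e0.
have cf0 : continuous (@dmap K E K^o U j f0).
  by have /asboolP[_ _] := Cinf_val_smooth f0; exact.
have := @Cinf_dmap_continuous K E K^o U j f0.
move=> /(compact_open_fam_compactP cf0)/fam_cvgP/(_ Q cQ) h.
have ent : @entourage K^o [set xy | `|xy.1 - xy.2| < e].
  by rewrite -entourage_ballE; exists e.
have : nbhs (@dmap K E K^o U j f0 : {uniform` Q -> K^o})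
  [set g : {uniform` Q -> K^o} | forall p, Q p -> `|@dmap K E K^o U j f0 p - g p| < e].
  by apply/uniform_nbhs; exists [set xy | `|xy.1 - xy.2| < e]; split.
have FF : Filter (@Cinf_dmap K E K^o U j f @[f --> f0]).
  by apply: fmap_filter; exact: nbhs_filter.
by move=> /(h FF FF).
Qed.

Lemma Cinf_iter_near (K : numFieldType) (E : tvsType K) (U : set E) (f0 : Cinf K^o U)
    (X : topologicalType) (a : X -> U) (ys : seq (X -> E)) (Q : set X) (e : K) :
  continuous a -> (forall i, continuous (nth (cst 0) ys i)) -> compact Q -> 0 < e ->
  \forall f \near f0, forall p, Q p ->
    `|iter_derive f0 [seq y p | y <- ys] (a p) -
      iter_derive (f : Cinf K^o U) [seq y p | y <- ys] (a p)| < e.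
Proof.
move=> ca cys cQ e0.
pose g p : U * {ptws 'I_(size ys) -> E} :=
  (a p, (fun i : 'I_(size ys) => nth (cst 0) ys i p)).
have cg : continuous g by exact: dmap_point_continuous.
have cgQ : compact (g @` Q).
  by apply: continuous_compact => //; exact: continuous_subspaceT.
have := Cinf_dmap_near f0 cgQ e0; apply: filterS => f H p Qp.
by rewrite -!dmap_seq; apply: H; exists p.
Qed.

(** The directions as functions of the argument of [dmap], so that statements about
    parameter-dependent directions specialise to [dmap]. *)
Definition ptws_coordinates (X : Type) (E : Type) j : seq (X * {ptws 'I_j -> E} -> E) :=
  [seq (fun p => p.2 i) | i <- enum 'I_j].

Lemma map_ptws_coordinates (X E : Type) j (p : X * {ptws 'I_j -> E}) :
  [seq y p | y <- @ptws_coordinates X E j] = codom p.2.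
Proof. by rewrite codomE /ptws_coordinates -map_comp. Qed.

Lemma ptws_coordinates_continuous (K : numFieldType) (E : tvsType K) (X : topologicalType) j i :
  continuous (nth (cst 0) (@ptws_coordinates X E j) i).
Proof.
case: j => [|j]; first by rewrite /ptws_coordinates enum_ord0 nth_nil; exact: cst_continuous.
apply: (nth_map_continuous (x0 := ord0)) => k p.
apply: (@continuous_comp _ _ _ snd (fun g : {ptws 'I_j.+1 -> E} => g _)); first exact: cvg_snd.
exact: ptws_proj_continuous.
Qed.

(** * Smoothness of X_f and continuity of f |-> X_f *)

Section hamiltonian_smooth.
Context {R : realType} {K : numFieldType} (sc : scalars R K) {E : lcsType K}.
Context (br : dualc E -> dualc E -> dualc E) (hE : lc_poisson R br).
Context (U : set E) (hU : open U).

Lemma hamiltonian_smooth (f : U -> K^o) : f \in @smooth K E K^o U ->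
  (hamiltonian br f) \in @smooth K E E U.
Proof.
move=> sf.
have cT (X : topologicalType) (a : X -> U) (ys : seq (X -> E)) :
    continuous a -> (forall i, continuous (nth (cst 0) ys i)) ->
    continuous (fun p => iter_derive (hamiltonian br f) [seq y p | y <- ys] (a p)).
  move=> ca cys.
  have -> : (fun p => iter_derive (hamiltonian br f) [seq y p | y <- ys] (a p)) =
      fun p => hamiltonian_derive br f [seq y p | y <- ys] (a p).
    by apply/funext => p; rewrite (iter_derive_hamiltonian sc hE hU sf).
  apply: (@polarization_continuous K E E U (hamiltonian_derive br f)) => //.
  - by move=> zs zs1 x; exact: (hamiltonian_derive_perm sc br hU sf).
  - by move=> c y z zs x; exact: (hamiltonian_derive_linear sc hE hU sf).
  - by move=> n; exact: (hamiltonian_derive_diag_continuous sc hE hU sf).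
apply/asboolP; split.
- have := cT U id [::]; apply; first by move=> x; exact: cvg_id.
  by move=> i; rewrite nth_nil; exact: cst_continuous.
- by move=> ys y x; exact: (hamiltonian_derivable sc hE hU sf).
- move=> j.
  have -> : @dmap K E E U j (hamiltonian br f) = (fun p => iter_derive (hamiltonian br f)
      [seq y p | y <- @ptws_coordinates U E j] p.1).
    by apply/funext => p; rewrite /dmap map_ptws_coordinates.
  apply: (cT (U * {ptws 'I_j -> E})%type fst); first by move=> p; exact: cvg_fst.
  exact: ptws_coordinates_continuous.
Qed.

Lemma hamiltonianDZ (c : K) (f g : U -> K^o) :
  f \in @smooth K E K^o U -> g \in @smooth K E K^o U ->
  hamiltonian br (c *: f + g) = c *: hamiltonian br f + hamiltonian br g.
Proof.
move=> sf sg; apply/funext => x.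
have hamE h : hamiltonian br h x = pairing br (iter_differential h [::] x) (\val x) by [].
rewrite hamE (iter_differentialDZ sc hU c [::] x sf sg).
exact: (pairing_linearl hE (\val x) c
  (iter_differential f [::] x) (iter_differential g [::] x)).
Qed.

Section continuity.
Variables (f0 : Cinf K^o U) (X : topologicalType) (a : X -> U) (Q : set X).
Hypotheses (ca : continuous a) (cQ : compact Q).

Lemma iter_differential_near (ys : seq (X -> E)) (L : set E) (e : K) :
  (forall i, continuous (nth (cst 0) ys i)) -> compact L -> 0 < e ->
  \forall f \near f0, forall p z, Q p -> L z ->
    `|iter_differential f0 [seq y p | y <- ys] (a p) z -
      iter_differential (f : Cinf K^o U) [seq y p | y <- ys] (a p) z| < e.
Proof.
move=> cys cL e0.
pose zs : seq (X * E -> E) := snd :: [seq y \o fst | y <- ys].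
have czs i : continuous (nth (cst 0) zs i).
  case: i => [|i] /=; first by move=> q; exact: cvg_snd.
  apply: (nth_map_continuous (x0 := cst 0)) => k q.
  by apply: (@continuous_comp _ _ _ fst); [exact: cvg_fst|exact: cys].
have ca' : continuous (a \o fst : X * E -> U).
  by move=> q; apply: (@continuous_comp _ _ _ fst a); [exact: cvg_fst|exact: ca].
have := Cinf_iter_near f0 ca' czs (compact_setX cQ cL) e0.
apply: filterS => f H p z Qp Lz.
have := H (p, z) (conj Qp Lz); rewrite /= -map_comp.
rewrite (iter_differentialE sc hU _ (a p) z (Cinf_val_smooth f0)).
by rewrite (iter_differentialE sc hU _ (a p) z (Cinf_val_smooth f)).
Qed.

Lemma pairing_near (ys : seq (X -> E)) (u : X -> E) (C : set (dualc E)) (e : K) :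
  (forall i, continuous (nth (cst 0) ys i)) -> continuous u -> compact C -> 0 < e ->
  \forall f \near f0, forall p (m : dualc E), Q p -> C m ->
    `|m (pairing br (iter_differential f0 [seq y p | y <- ys] (a p)) (u p)) -
      m (pairing br (iter_differential (f : Cinf K^o U) [seq y p | y <- ys] (a p)) (u p))| < e.
Proof.
move=> cys cu cC e0.
have cM : compact (u @` Q).
  by apply: continuous_compact => //; exact: continuous_subspaceT.
(* Hypocontinuity is invoked at 0 and applied to differences of differentials, so that a single
   neighbourhood serves every [p] in [Q]. *)
have /dualc_nbhsP[L [d [cL d0 dL]]] := pairing_hypo hE 0 cM cC e0.
have := iter_differential_near cys cL d0; apply: filterS => f H p m Qp Cm.
set l0 := iter_differential f0 _ _; set l := iter_differential f _ _.
have lin := pairing_linearl hE (u p).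
have /dL/(_ (u p) m) : [set l' : dualc E |
    forall z, L z -> `|(0 : dualc E) z - l' z| < d] (l0 - l).
  by move=> z Lz; rewrite -[X in X - _]/(0 : K) sub0r normrN; exact: H.
rewrite (linear_fun0 lin) (linear_fun0 (@dualc_linear _ _ m)) sub0r normrN.
rewrite (linear_funB lin l0 l) dualcB; apply=> //.
Qed.

(** [pre] holds the directions that the recursion of [leibniz_sum] has passed; they remain arguments
    of the differentials and still vary with [p]. *)
Lemma leibniz_sum_near (pre ys : seq (X -> E)) (C : set (dualc E)) (e : K) :
  (forall i, continuous (nth (cst 0) pre i)) -> (forall i, continuous (nth (cst 0) ys i)) ->
  compact C -> 0 < e ->
  \forall f \near f0, forall p (m : dualc E), Q p -> C m ->
    `|m (leibniz_sum br (fun r => iter_differential f0 ([seq y p | y <- pre] ++ r) (a p))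
          [seq y p | y <- ys]) -
      m (leibniz_sum br (fun r => iter_differential (f : Cinf K^o U)
          ([seq y p | y <- pre] ++ r) (a p)) [seq y p | y <- ys])| < e.
Proof.
move=> + + cC; elim: ys pre e => [|y ys IH] pre e cpre cys e0 /=.
  by apply: filterE => f p m _ _; rewrite subrr normr0.
have e20 : 0 < e / 2 by rewrite divr_gt0.
have cy : continuous y := cys 0.
have {}cys i : continuous (nth (cst 0) ys i) := cys i.+1.
have ccat i : continuous (nth (cst 0) (pre ++ ys) i).
  by rewrite nth_cat; case: ifP.
have crcons i : continuous (nth (cst 0) (rcons pre y) i).
  rewrite nth_rcons; case: ifP => // _; case: ifP => // _; exact: cst_continuous.
have n1 := pairing_near ccat cy cC e20.
have n2 := IH (rcons pre y) _ crcons cys e20.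
move: n1 n2; apply: filterS2 => f H1 H2 p m Qp Cm.
have := ltrD (H1 p m Qp Cm) (H2 p m Qp Cm); rewrite -splitr; apply: le_lt_trans.
have mD w w' : m (w + w') = m w + m w' by exact: (linear_funD (@dualc_linear _ _ m)).
rewrite !mD opprD addrACA (le_trans (ler_normD _ _))//.
rewrite map_cat map_rcons.
have rc h : (fun r => iter_differential h (rcons [seq y p | y <- pre] (y p) ++ r) (a p)) =
    (fun r => iter_differential h ([seq y p | y <- pre] ++ y p :: r) (a p)).
  by apply/funext => r; rewrite cat_rcons.
by rewrite (rc f0) (rc f).
Qed.

Lemma hamiltonian_derive_near (ys : seq (X -> E)) (C : set (dualc E)) (e : K) :
  (forall i, continuous (nth (cst 0) ys i)) -> compact C -> 0 < e ->
  \forall f \near f0, forall p (m : dualc E), Q p -> C m ->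
    `|m (hamiltonian_derive br f0 [seq y p | y <- ys] (a p)) -
      m (hamiltonian_derive br (f : Cinf K^o U) [seq y p | y <- ys] (a p))| < e.
Proof.
move=> cys cC e0; have e20 : 0 < e / 2 by rewrite divr_gt0.
have cu : continuous (fun p => \val (a p)).
  by move=> p; apply: (@continuous_comp _ _ _ a); [exact: ca|exact: val_continuous].
have cnil i : continuous (nth (cst 0) ([::] : seq (X -> E)) i).
  by rewrite nth_nil; exact: cst_continuous.
have n1 := pairing_near cys cu cC e20.
have n2 := leibniz_sum_near cnil cys cC e20.
move: n1 n2; apply: filterS2 => f H1 H2 p m Qp Cm.
have := ltrD (H1 p m Qp Cm) (H2 p m Qp Cm); rewrite -splitr; apply: le_lt_trans.
rewrite /hamiltonian_derive.
have mD w w' : m (w + w') = m w + m w' by exact: (linear_funD (@dualc_linear _ _ m)).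
by rewrite !mD opprD addrACA (le_trans (ler_normD _ _)).
Qed.

End continuity.

Lemma hamiltonian_continuous (Psi : Cinf K^o U -> Cinf E U) :
  (forall f : Cinf K^o U, Psi f = hamiltonian br f :> (U -> E)) -> continuous Psi.
Proof.
move=> PsiE f0; apply: (Cinf_cvg (nbhs_filter f0)) => j.
have FF : Filter (@Cinf_dmap K E E U j (Psi f) @[f --> f0]).
  by apply: fmap_filter; exact: nbhs_filter.
apply/compact_open_cvgP => Q O cQ oO f0QO.
pose ys := @ptws_coordinates U E j.
have ca : continuous (fst : U * {ptws 'I_j -> E} -> U) by move=> p; exact: cvg_fst.
have cys i : continuous (nth (cst 0) ys i) by exact: ptws_coordinates_continuous.
have dE (f : Cinf K^o U) p : @Cinf_dmap K E E U j (Psi f) p =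
    hamiltonian_derive br f [seq y p | y <- ys] p.1.
  rewrite /Cinf_dmap /dmap PsiE (iter_derive_hamiltonian sc hE hU (Cinf_val_smooth f)).
  by rewrite map_ptws_coordinates.
have cf0 : continuous (@Cinf_dmap K E E U j (Psi f0)).
  by have /asboolP[_ _] := Cinf_val_smooth (Psi f0); exact.
suff : \forall f \near f0, forall p, Q p -> O (@Cinf_dmap K E E U j (Psi f) p).
  by apply: filterS => f fO _ [p Qp <-]; exact: fO.
move/compact_near_coveringP/near_covering_withinP: (cQ) => cov.
(* The seminorm ball inside [O] depends on the value at [p0], so the claim is localised by
   compactness of [Q]. One half of its radius [e] is spent on moving [p], the other on moving
   [f]. *)
apply: (cov _ (nbhs f0) (fun f p => O (@Cinf_dmap K E E U j (Psi f) p))) => p0 Qp0.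
have : nbhs (@Cinf_dmap K E E U j (Psi f0) p0) O.
  by apply: open_nbhs_nbhs; split => //; apply: f0QO; exists p0.
move=> /(nbhs_lcsP hE)[C [e [cC e0 CO]]].
have e20 : 0 < e / 2 by rewrite divr_gt0.
have n1 := cf0 _ _ (nbhs_lcs_ball hE (@Cinf_dmap K E E U j (Psi f0) p0) cC e20).
have n2 := hamiltonian_derive_near f0 ca cQ cys cC e20.
pose N1 := [set p | forall m : dualc E, C m ->
    `|m (@Cinf_dmap K E E U j (Psi f0) p0) -
      m (@Cinf_dmap K E E U j (Psi f0) p)| < e / 2].
pose N2 := [set f : Cinf K^o U | forall p (m : dualc E), Q p -> C m ->
    `|m (hamiltonian_derive br f0 [seq y p | y <- ys] p.1) -
      m (hamiltonian_derive br f [seq y p | y <- ys] p.1)| < e / 2].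
exists (N1, N2); first by split; [exact: n1|exact: n2].
move=> [p f] /= [H1 H2] Qp; apply: CO => m Cm.
have := ltrD (H1 m Cm) (H2 p m Qp Cm); rewrite -splitr; apply: le_lt_trans.
rewrite -!dE -(subrK (m (@Cinf_dmap K E E U j (Psi f0) p)) (m (@Cinf_dmap K E E U j (Psi f0) p0))).
by rewrite -addrA (le_trans (ler_normD _ _))// subrK.
Qed.

End hamiltonian_smooth.

Theorem theorem12p1 (R : realType) (K : numFieldType)
    (hK : real_or_complex R K) (E : lcsType K)
    (br : dualc E -> dualc E -> dualc E) (hE : lc_poisson R br)
    (U : set E) (hU : open U) :
  exists Psi : {linear Cinf K^o U -> Cinf E U},
    (forall f : Cinf K^o U, Psi f = hamiltonian br f :> (U -> E)) /\
    continuous Psi.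
Proof.
have [sc] := real_or_complex_scalars hK.
pose psi (f : Cinf K^o U) : Cinf E U :=
  MkCinf (hamiltonian_smooth sc hE hU (Cinf_val_smooth f)).
have psi_linear : linear psi.
  move=> c f g; apply: val_inj.
  exact: (hamiltonianDZ sc hE hU c (Cinf_val_smooth f) (Cinf_val_smooth g)).
pose Psi : {linear Cinf K^o U -> Cinf E U} :=
  HB.pack psi (GRing.isLinear.Build K _ _ _ psi psi_linear).
exists Psi; split => //.
exact: (hamiltonian_continuous sc hE hU).
Qed.
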